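(* Assume that $\varphi$ satisfies Conditions (C1), (C2), (C3), (C4) described in the context. Then the space $C_0^\infty(\Omega)$ of infinitely differentiable compactly supported functions is a dense subset of the normed space $(\mathcal L(\Omega),f)$, and $\mathcal L(\Omega)$ is separable.
   Context: Let $d\ge 1$ and let $\Omega\subseteq\mathbb R^d$ be a domain (open set, bounded or unbounded, possibly $\Omega=\mathbb R^d$). Functions are complex-valued. Let $a\in L_1(\mathbb R^d)$, $a\ge 0$, and suppose there is a non-empty ball $B_0$ centered at $0$ with $a(z)\ge c_0>0$ for a.e. $z\in B_0$. If $\Omega$ is not connected and $\Omega_1,\Omega_2,\dots$ are its connected components, assume $\operatorname{dist}(\Omega_i,\Omega_{i+1})<\operatorname{diam}B_0$ for all $i$. A real function $r$ on $[0,\infty)$ is almost increasing (resp. almost decreasing) with constant $\beta\ge1$ if $r(s)\le\beta r(t)$ (resp. $\beta r(s)\ge r(t)$) for all $0\le s\le t$. Let $\varphi:[0,\infty)\times\Omega\times\Omega\to[0,\infty)$. Conditions: (C1) for each $u\in L_{1,loc}(\Omega)$ the function $(x,y)\mapsto\varphi(|u(x)-u(y)|,x,y)$ is measurable on $\Omega\times\Omega$; (C2) for every $\varepsilon>0$ there is $\delta\in(0,1)$ such that $\varphi(\frac{s+t}{2},x,y)\le(1-\delta)\frac{\varphi(s,x,y)+\varphi(t,x,y)}{2}$ for a.e. $(x,y)$ and all $s,t>0$ with $|s-t|\ge\varepsilon\max\{s,t\}$; (C3) there are constants $1<p_-\le p_+$ and $\beta\ge1$ such that for a.e. $(x,y)$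 the function $t\mapsto\varphi(t,x,y)/t^{p_-}$ is almost increasing with constant $\beta$ and $t\mapsto\varphi(t,x,y)/t^{p_+}$ is almost decreasing with constant $\beta$; (C4) for a.e. $(x,y)$: $c_1^{-1}\le\varphi(1,x,y)\le c_1$ with a constant $c_1>0$, $\varphi(0,x,y)=0$, and $\varphi(t,x,y)>0$ for $t>0$. Define for $u\in L_{1,loc}(\Omega)$: $F(u)=\int_{\Omega\times\Omega}\varphi(|u(x)-u(y)|,x,y)\,a(x-y)\,dx\,dy\in[0,+\infty]$, $|u|_{p,\Omega}=\inf\{\lambda>0: F(u/\lambda)\le1\}$, $f(u)=|u|_{p,\Omega}+\|u\|_{L_{p_-}(\Omega)}$, and $\mathcal L(\Omega)=\{u\in L_{p_-,loc}(\Omega): f(u)<+\infty\}$, normed by $f$. *)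

(* Defs.v *)
From HB Require Import structures.
From mathcomp Require Import all_boot all_order all_algebra.
From mathcomp Require Import all_classical all_reals all_analysis.
From mathcomp Require Import complex.
Set Implicit Arguments. Unset Strict Implicit. Unset Printing Implicit Defensive.
Import Order.TTheory GRing.Theory Num.Theory.
Import numFieldNormedType.Exports.
Local Open Scope classical_set_scope.
Local Open Scope ring_scope.

Definition Rd (R : realType) (d : nat) :=
  g_sigma_algebraType (@open 'rV[R]_d).

Definition enorm (R : realType) (d : nat) (x : 'rV[R]_d) : R :=
  Num.sqrt (\sum_(i < d) (x ord0 i) ^+ 2).

Definition box (R : realType) (d : nat) (a b : 'rV[R]_d) : set 'rV[R]_d :=
  [set x | forall i, a ord0 i <= x ord0 i <= b ord0 i].

(** [mu] is (the Borel restriction of) d-dimensional Lebesgue measure: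
    it gives every box its volume.  A measure on the Borel sets with this
    property is unique, so this characterizes Lebesgue measure on Borel sets;
    Lebesgue-measurable sets/functions are handled via [lmeasurable] below
    (completion). *)
Definition is_lebesgue (R : realType) (d : nat)
    (mu : set (Rd R d) -> \bar R) : Prop :=
  forall a b : 'rV[R]_d, (forall i, a ord0 i <= b ord0 i) ->
    mu (box a b) = (\prod_(i < d) (b ord0 i - a ord0 i))%:E.

Definition sdist (R : realType) (d : nat) (A B : set 'rV[R]_d) : R :=
  inf [set r | exists x y, A x /\ B y /\ r = enorm (x - y)].

Definition cmod (R : realType) (z : R[i]) : R := Normc.normc z.

(** [f] is measurable on [D] for the completion of [mu]: it agrees
    [mu]-a.e. on [D] with a Borel measurable function. *)
Definition lmeasurable (dT : measure_display) (T : measurableType dT)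
    (R : realType) (mu : {measure set T -> \bar R}) (D : set T) (f : T -> R) :=
  exists g : T -> R, measurable_fun D g /\ {ae mu, forall x, D x -> f x = g x}.

Fixpoint Ck (R : realType) (d : nat) (k : nat) (f : 'rV[R]_d -> R) : Prop :=
  match k with
  | 0 => continuous f
  | k.+1 => (forall x, differentiable f x) /\ (forall v, Ck k ('D_v f))
  end.

Definition smooth (R : realType) (d : nat) (f : 'rV[R]_d -> R) : Prop :=
  forall k, Ck k f.

(** C_0^infty(Omega): complex-valued smooth functions whose support
    (closure of the non-zero set) is compact and contained in Omega
    (i.e. extended by zero outside Omega). *)
Definition C0inf (R : realType) (d : nat) (Om : set 'rV[R]_d)
    (g : 'rV[R]_d -> R[i]) : Prop :=
  smooth (fun x => complex.Re (g x)) /\ smooth (fun x => complex.Im (g x)) /\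
  compact (closure [set x | g x != 0]) /\ closure [set x | g x != 0] `<=` Om.

Section Spaces.
Variables (R : realType) (d : nat) (mu : {sigma_finite_measure set (Rd R d) -> \bar R}).
Variables (Om : set 'rV[R]_d).

Definition Lploc (p : R) (u : 'rV[R]_d -> R[i]) : Prop :=
  lmeasurable mu (Om : set (Rd R d)) (fun x : Rd R d => complex.Re (u x)) /\
  lmeasurable mu (Om : set (Rd R d)) (fun x : Rd R d => complex.Im (u x)) /\
  forall K : set 'rV[R]_d, compact K -> K `<=` Om ->
    (\int[mu]_(x in (K : set (Rd R d))) ((cmod (u x)) `^ p)%:E < +oo)%E.

Definition Lpnorm (p : R) (u : 'rV[R]_d -> R[i]) : \bar R :=
  ((\int[mu]_(x in (Om : set (Rd R d))) ((cmod (u x)) `^ p)%:E) `^ p^-1)%E.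

Variables (phi : R -> 'rV[R]_d -> 'rV[R]_d -> R) (a : 'rV[R]_d -> R).

Definition Ffun (u : 'rV[R]_d -> R[i]) : \bar R :=
  (\int[mu \x mu]_(z in (Om : set (Rd R d)) `*` (Om : set (Rd R d)))
     (phi (cmod (u z.1 - u z.2)) z.1 z.2 *
      a ((z.1 : 'rV[R]_d) - (z.2 : 'rV[R]_d)))%:E)%E.

(** |u|_{p,Om} = inf { lambda > 0 : F(u/lambda) <= 1 }  (inf of empty = +oo) *)
Definition seminormF (u : 'rV[R]_d -> R[i]) : \bar R :=
  ereal_inf [set (l%:E)%E | l in
     [set l : R | 0 < l /\ (Ffun (fun x => (u x / real_complex R l)%R) <= 1)%E]].

Definition fnorm (pm : R) (u : 'rV[R]_d -> R[i]) : \bar R :=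
  (seminormF u + Lpnorm pm u)%E.

Definition Lcal (pm : R) (u : 'rV[R]_d -> R[i]) : Prop :=
  Lploc pm u /\ (fnorm pm u < +oo)%E.

End Spaces.

(* Main.v *)
Require Import Defs.
From HB Require Import structures.
From mathcomp Require Import all_boot all_order all_algebra.
From mathcomp Require Import all_classical all_reals all_analysis.
From mathcomp Require Import complex.
From mathcomp Require Import lra ring measurable_realfun.
Import Order.TTheory GRing.Theory Num.Theory.
Import numFieldNormedType.Exports.
Local Open Scope classical_set_scope.
Local Open Scope ring_scope.

(** The increment function [phi(t,x,y)] is at most a constant times
    [theta t = t^pm + t^pp], so that [F] is controlled by the modular
    [w |-> int theta(|w|)] and the total mass of [a].  Given [u] in the space,
    clamp its real and imaginary parts at height [n].  Increments of [u - u_n]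
    are dominated by those of [u] and vanish off a set shrinking to the empty
    set, so [F] of a multiple of [u - u_n] tends to 0 by dominated convergence,
    using the doubling property of [phi].  The bounded function [u_n] is then
    approximated in the modular: level sets of its real and imaginary parts
    have finite measure, a sigma-algebra argument approximates these by finite
    Boolean combinations of boxes contained in [Om], and the indicator of a box
    is the bounded pointwise limit of products of functions [exp(-1/t)].  With
    rational data the approximants form a countable family, which gives density
    and separability at once. *)

(** Truncation is forced by the gap between [pm] and [pp]: membership of [u] gives [F(u/l0) <= 1]
    for one [l0] and an [L_pm] bound, but not integrability of [|u|^pp]. Hence the cut-off part is
    measured by [phi] itself at the scale [l0], where an integrable majorant exists, and only the
    bounded remainder by powers, where [t^pp] is at most a constant times [t^pm]. The cut-off part
    has increments dominated by those of [u] because [t - clamp N t] is 1-Lipschitz in [t]. Powers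
    control [F] through a convolution: the double integral of [theta(|w(x)|) a(x-y)] is the product
    of the integrals of [theta(|w|)] and [a], by invariance of Lebesgue measure under translation
    and reflection. Functions are Borel only up to null sets. Integrals of nonnegative functions are
    suprema over simple functions, so a.e. comparison needs no measurability, and (C1) at [u/l0]
    yields the Borel majorant to which dominated convergence applies. Bumps with values in [0,1]
    turn Boolean operations on sets into polynomial operations on functions, so the approximants
    stay inside a countable algebra. *)

Set Implicit Arguments.
Unset Strict Implicit.

(** * Integrals of nonnegative, possibly non-measurable functions *)

Section IntegralFacts.
Context d (T : measurableType d) (R : realType) (mu : {measure set T -> \bar R}).
Local Open Scope ereal_scope.
Import HBNNSimple.

(** A simple function below [f], set to zero on the exceptional null set, lies below [g] and keeps
    its integral. Neither [f] nor [g] has to be measurable. *)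
Lemma le_integral_ae (D : set T) (f g : T -> \bar R) :
  (forall x, D x -> 0 <= f x) -> (forall x, D x -> 0 <= g x) ->
  {ae mu, forall x, D x -> f x <= g x} ->
  \int[mu]_(x in D) f x <= \int[mu]_(x in D) g x.
Proof.
move=> f0 g0 [N [mN N0 subN]].
rewrite (integral_mkcond D f) (integral_mkcond D g).
have f'0 x : 0 <= (f \_ D) x by exact: erestrict_ge0.
have g'0 x : 0 <= (g \_ D) x by exact: erestrict_ge0.
rewrite ge0_integralTE// ge0_integralTE//.
apply: ge_ereal_sup => _ [h /= hf <-].
apply: ereal_sup_ubound; exists (proj_nnsfun h (measurableC mN)).
  move=> x; rewrite -(mrestrict h (measurableC mN)) patchE; case: ifPn => [|_]; last exact: g'0.
  rewrite inE /= => Nx; apply: le_trans (hf x) _.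
  rewrite !patchE; case: ifPn => // /set_mem Dx.
  by apply: contrapT => fg; apply: Nx; apply: subN => /(_ Dx).
rewrite -(mrestrict h (measurableC mN)) -[RHS]integralT_nnsfun.
rewrite (ge0_negligible_integral mN)//; last 2 first.
- exact/measurable_EFinP.
- by move=> x _; rewrite lee_fin; exact: fun_ge0.
by rewrite integral_nnsfun ?setTD//; exact: measurableC.
Qed.

Lemma dominated_near (f : nat -> T -> R) (g : T -> R) :
  (forall n, measurable_fun setT (f n)) -> measurable_fun setT g ->
  (forall n x, (0 <= f n x <= g x)%R) ->
  (forall x, f ^~ x @ \oo --> (0 : R)%R) ->
  \int[mu]_x (g x)%:E < +oo ->
  forall e : R, (0 < e)%R -> \forall n \near \oo, \int[mu]_x (f n x)%:E < e%:E.
Proof.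
move=> mf mg fg f0 ig e e0.
have g0 x : (0 <= g x)%R by have /andP[a b] := fg 0%N x; exact: le_trans a b.
have [] := @dominated_convergence _ T R mu setT measurableT
  (fun n x => (f n x)%:E) (cst 0) (fun x => (g x)%:E).
- by move=> n; exact/measurable_EFinP.
- exact: measurable_cst.
- apply: aeW => x _; apply/fine_cvgP; split; first by exact: nearW.
  by rewrite [X in X @ _ --> _](_ : _ = f ^~ x)//; exact: f0.
- apply/integrableP; split; first exact/measurable_EFinP.
  by under eq_integral do rewrite gee0_abs ?lee_fin//.
- apply: aeW => x n _; rewrite gee0_abs lee_fin; by have /andP[] := fg n x.
move=> _ _; rewrite integral_cst// mul0e => /fine_cvgP[fin].
move=> /cvgr0Pnorm_lt /(_ e e0) lt.
near=> n; have finn : \int[mu]_x (f n x)%:E \is a fin_num by near: n.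
rewrite -(fineK finn) lte_fin; apply: (@le_lt_trans _ _ `|fine (\int[mu]_x (f n x)%:E)|%R).
  exact: ler_norm.
by near: n.
Unshelve. all: by end_near. Qed.

Lemma dominated_small (f : nat -> T -> R) (g : T -> R) :
  (forall n, measurable_fun setT (f n)) -> measurable_fun setT g ->
  (forall n x, (0 <= f n x <= g x)%R) ->
  (forall x, f ^~ x @ \oo --> (0 : R)%R) ->
  \int[mu]_x (g x)%:E < +oo ->
  forall e : R, (0 < e)%R -> exists n, \int[mu]_x (f n x)%:E < e%:E.
Proof.
by move=> mf mg fg f0 ig e e0; exact: filter_ex (dominated_near mf mg fg f0 ig e0).
Qed.
End IntegralFacts.

(** * Lebesgue measure on R^d *)

Section Euclid.
Context (R : realType) (d : nat).
Implicit Types (a b x y : 'rV[R]_d) (O : set 'rV[R]_d).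

Definition obox a b : set 'rV[R]_d :=
  [set x | forall i, a ord0 i < x ord0 i < b ord0 i].

Lemma obox_sub_box a b : obox a b `<=` box a b.
Proof. by move=> x xab i; have /andP[/ltW -> /ltW ->] := xab i. Qed.

Lemma measurable_open O : open O -> measurable (O : set (Rd R d)).
Proof. exact: sub_sigma_algebra. Qed.

Lemma measurable_closed O : closed O -> measurable (O : set (Rd R d)).
Proof.
by move=> cO; rewrite -(setCK O); apply: measurableC; apply: measurable_open;
  rewrite openC.
Qed.

Lemma compact_box a b : compact (box a b).
Proof.
rewrite (_ : box a b =
    [set v : 'rV[R]_d | forall i, `[a ord0 i, b ord0 i]%classic (v ord0 i)]).
  apply: (@rV_compact _ _ (fun i => `[a ord0 i, b ord0 i]%classic)) => i.
  exact: segment_compact.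
by apply/seteqP; split => x /= xab i; have := xab i; rewrite in_itv.
Qed.

Lemma closed_box a b : closed (box a b).
Proof. by apply: compact_closed; [exact: norm_hausdorff|exact: compact_box]. Qed.

Lemma measurable_box a b : measurable (box a b : set (Rd R d)).
Proof. by apply: measurable_closed; exact: closed_box. Qed.

Lemma continuous_measurable_Rd (f : 'rV[R]_d -> R) :
  continuous f -> measurable_fun setT (f : Rd R d -> R).
Proof.
move=> /continuousP cf; apply: (measurability _ (RGenOpens.measurableE R)).
move=> _ [_ [u [v ->]] <-]; rewrite setTI; apply: measurable_open.
by apply: cf; exact: interval_open.
Qed.

Lemma measurable_coord i : measurable_fun setT (fun x : Rd R d => (x : 'rV[R]_d) ord0 i).
Proof. by apply: continuous_measurable_Rd; exact: coord_continuous. Qed.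

Lemma rat_box_nbhs O x : open O -> O x -> exists a b : 'rV[rat]_d,
  obox (map_mx ratr a) (map_mx ratr b) x /\
  box (map_mx ratr a) (map_mx ratr b) `<=` O.
Proof.
move=> oO Ox; have /nbhs_ballP[e /= e0 eO] : nbhs x O by exact: open_nbhs_nbhs.
have /choice[p hp] : forall i, exists q : rat, x ord0 i - e < ratr q < x ord0 i.
  move=> i; have : x ord0 i - e < x ord0 i by rewrite ltrBlDr ltrDl.
  by move=> /rat_in_itvoo[q]; rewrite in_itv; exists q.
have /choice[q hq] : forall i, exists q : rat, x ord0 i < ratr q < x ord0 i + e.
  move=> i; have : x ord0 i < x ord0 i + e by rewrite ltrDl.
  by move=> /rat_in_itvoo[q]; rewrite in_itv; exists q.
exists (\row_i p i), (\row_i q i); split => [i|y yab].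
  by rewrite !mxE; have /andP[_ ->] := hp i; have /andP[-> _] := hq i.
apply: eO; split => // i j; rewrite ord1 {i}.
have := yab j; rewrite !mxE => /andP[ay yb].
have /andP[xp px] := hp j; have /andP[xq qx] := hq j.
rewrite /ball /= ltr_distlC; apply/andP; split.
  by apply: lt_le_trans ay.
by apply: le_lt_trans qx.
Qed.

(** Each piece comes with its closed box inside [O]: for [O = Om] that box is a compact subset of
    [Om] carrying the bumps built on the piece. Integers that decode to no admissible pair
    contribute [set0]. *)
Lemma open_bigcup_boxes O : open O -> exists F : nat -> set 'rV[R]_d,
  (forall n, F n = set0 \/ exists a b : 'rV[rat]_d,
     F n = obox (map_mx ratr a) (map_mx ratr b) /\
     box (map_mx ratr a) (map_mx ratr b) `<=` O) /\
  \bigcup_n F n = O.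
Proof.
move=> oO.
pose F n := if @unpickle ('rV[rat]_d * 'rV[rat]_d)%type n is Some ab then
  if `[< box (map_mx ratr ab.1) (map_mx ratr ab.2) `<=` O >]
  then obox (map_mx ratr ab.1) (map_mx ratr ab.2) else set0 else set0.
exists F; split => [n|].
  rewrite /F; case: unpickle => [[a b]|]; last by left.
  by case: asboolP => /= ab; [right; exists a, b|left].
apply/seteqP; split => [x [n _]|x Ox].
  rewrite /F; case: unpickle => [[a b]|//].
  by case: asboolP => //= ab /obox_sub_box; exact: ab.
have [a [b [xab abO]]] := rat_box_nbhs oO Ox.
exists (pickle (a, b)) => //; rewrite /F pickleK /=.
by case: asboolP.
Qed.

(** The sigma-algebra of [Rd] is generated by open sets. An open set is a countable union of open
    boxes, whose preimages are finite intersections of coordinate preimages. *)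
Lemma measurable_fun_Rd d' (T : measurableType d') (f : T -> Rd R d) :
  (forall i, measurable_fun setT (fun t => (f t : 'rV[R]_d) ord0 i)) ->
  measurable_fun setT f.
Proof.
move=> mf; have G : @measurable _ (Rd R d) = <<s @open _ >> by [].
apply: (measurability _ G) => //.
move=> _ [U oU <-]; rewrite setTI.
have [F [hF <-]] := open_bigcup_boxes oU.
rewrite preimage_bigcup; apply: bigcupT_measurable => n.
have [->|[a [b [-> _]]]] := hF n; first by rewrite preimage_set0.
rewrite [X in measurable X](_ : _ = \bigcap_(i in [set: 'I_d])
  ((fun t => (f t : 'rV[R]_d) ord0 i) @^-1` `]ratr (a ord0 i), ratr (b ord0 i)[%classic)).
  apply: fin_bigcap_measurable => // i _.
  by rewrite -[X in measurable X]setTI; apply: mf.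
apply/seteqP; split => t /= h i; last by have := h i I; rewrite /= !mxE in_itv.
by move=> _ /=; have := h i; rewrite !mxE in_itv.
Qed.

Lemma measurable_subr : measurable_fun setT
  (fun z : Rd R d * Rd R d => ((z.1 : 'rV[R]_d) - (z.2 : 'rV[R]_d)) : Rd R d).
Proof.
apply: measurable_fun_Rd => i; under eq_fun do rewrite !mxE.
apply: measurable_funD; first exact: measurableT_comp (measurable_coord i) measurable_fst.
apply: measurableT_comp; first exact: oppr_measurable.
exact: measurableT_comp (measurable_coord i) measurable_snd.
Qed.
End Euclid.

(** * Invariance of Lebesgue measure and convolution integrals *)

Section Lebesgue.
Context (R : realType) (d : nat).
Implicit Types (a b x y : 'rV[R]_d).

Lemma coord_le_norm x i : `|x ord0 i| <= `|x|.
Proof.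
rewrite [leRHS]/Num.norm /= mx_normrE.
by apply/bigmax_geP; right => /=; exists (ord0, i).
Qed.

Lemma box_setI a b a' b' : box a b `&` box a' b' =
  box (\row_i Num.max (a ord0 i) (a' ord0 i)) (\row_i Num.min (b ord0 i) (b' ord0 i)).
Proof.
apply/seteqP; split => x /=.
  move=> [h h'] i; rewrite !mxE ge_max le_min.
  by have /andP[-> ->] := h i; have /andP[-> ->] := h' i.
move=> h; split => i; have := h i; rewrite !mxE ge_max le_min;
  by move=> /andP[/andP[? ?] /andP[? ?]]; apply/andP.
Qed.

Lemma measurable_Rd_box :
  @measurable _ (Rd R d) = <<s [set box ab.1 ab.2 | ab in [set: 'rV[R]_d * 'rV[R]_d]] >>.
Proof.
apply/seteqP; split; last first.
  apply: smallest_sub; first exact: sigma_algebra_measurable.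
  by move=> _ [[a b] _ <-]; exact: measurable_box.
apply: smallest_sub; first exact: smallest_sigma_algebra.
move=> U oU.
have [F [hF FU]] := open_bigcup_boxes oU.
(* Each open piece is enlarged to its closed box, which still lies in [U]; the union is unchanged
   and now consists of generators. *)
have /choice[C hC] : forall n, exists C : set 'rV[R]_d,
    <<s [set box ab.1 ab.2 | ab in [set: 'rV[R]_d * 'rV[R]_d]] >> C /\
    F n `<=` C /\ C `<=` U.
  move=> n; have [->|[a [b [-> abU]]]] := hF n.
    exists set0; split; last by split.
    by have [] := smallest_sigma_algebra setT
      [set box ab.1 ab.2 | ab in [set: 'rV[R]_d * 'rV[R]_d]].
  exists (box (map_mx ratr a) (map_mx ratr b)); split.
    by apply: sub_sigma_algebra; exists (map_mx ratr a, map_mx ratr b).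
  by split=> //; exact: obox_sub_box.
have -> : U = \bigcup_n C n.
  apply/seteqP; split.
    by rewrite -FU => x [n _ Fx]; exists n => //; apply: (hC n).2.1.
  by move=> x [n _]; apply: (hC n).2.2.
have [_ _ bc] := smallest_sigma_algebra setT
  [set box ab.1 ab.2 | ab in [set: 'rV[R]_d * 'rV[R]_d]].
by apply: bc => n; have [] := hC n.
Qed.

Context (mu : {sigma_finite_measure set (Rd R d) -> \bar R}).
Hypothesis hmu : is_lebesgue mu.

Lemma measure_box_fin a b : (mu (box a b) < +oo)%E.
Proof.
have [ab|nab] := pselect (forall i, a ord0 i <= b ord0 i).
  by rewrite hmu// ltry.
rewrite [X in mu X](_ : _ = set0) ?measure0//.
apply/seteqP; split => // x xab; apply: nab => i.
by have /andP[] := xab i; exact: le_trans.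
Qed.

Lemma bounded_sub_box (A : set 'rV[R]_d) : bounded_set A -> exists a b, A `<=` box a b.
Proof.
move=> [M [_ /(_ (M + 1))]]; rewrite ltrDl ltr01 => /(_ isT) AM.
exists (const_mx (- (M + 1))), (const_mx (M + 1)) => x /AM /= xM i.
by rewrite !mxE -ler_norml; exact: le_trans (coord_le_norm x i) xM.
Qed.

Lemma compact_measure_fin (K : set 'rV[R]_d) : compact K -> (mu K < +oo)%E.
Proof.
move=> cK; have [a [b Kab]] := bounded_sub_box (compact_bounded cK).
apply: le_lt_trans (measure_box_fin a b); apply: le_measure => //; rewrite inE.
- apply: measurable_closed; apply: compact_closed => //; exact: norm_hausdorff.
- exact: measurable_box.
Qed.

(** Uniqueness of measures on the intersection-stable family of boxes: [mu] and its image under [f]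
    agree there because side lengths are preserved. *)
Lemma lebesgue_preimage (f : Rd R d -> Rd R d) : measurable_fun setT f ->
  (forall a b, exists a' b', f @^-1` box a b = box a' b' /\
     forall i, b' ord0 i - a' ord0 i = b ord0 i - a ord0 i) ->
  forall A, measurable A -> mu (f @^-1` A) = mu A.
Proof.
move=> mf hf A mA.
pose mfB := isMeasurableFun.Build _ _ _ _ _ mf.
pose F : {mfun _ >-> _} := HB.pack f mfB.
apply/esym; change (mu A = pushforward mu F A).
apply: (@measure_unique _ R (Rd R d) [set box ab.1 ab.2 | ab in [set: 'rV[R]_d * 'rV[R]_d]]
  (fun n => box (const_mx (- n%:R)) (const_mx n%:R)) _ _ _ _ mu (pushforward mu F)) => //.
- exact: measurable_Rd_box.
- move=> _ _ [[a b] _ <-] [[a' b'] _ <-] /=; rewrite box_setI.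
  by eexists (_, _).
- by move=> n; exists (const_mx (- n%:R), const_mx n%:R).
- apply/seteqP; split => // x _; exists (Num.Def.archi_bound `|x|) => // i.
  rewrite !mxE -ler_norml; apply: le_trans (coord_le_norm _ _) _.
  by apply/ltW; exact: archi_boundP.
- move=> _ [[a b] _ <-] /=; rewrite /pushforward.
  have [a' [b' [-> e]]] := hf a b.
  (* [is_lebesgue] speaks only of boxes with ordered corners. Equal side lengths make both boxes
     disordered at once, and then both are empty. *)
  have le_iff i : (a' ord0 i <= b' ord0 i) = (a ord0 i <= b ord0 i).
    by rewrite -subr_ge0 e subr_ge0.
  have [ab|nab] := pselect (forall i, a ord0 i <= b ord0 i).
    rewrite !hmu//; last by move=> i; rewrite le_iff.
    by congr EFin; apply: eq_bigr => i _.
  suff E (u v : 'rV[R]_d) : ~ (forall i, u ord0 i <= v ord0 i) -> box u v = set0 :> set 'rV[R]_d.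
    rewrite !E//; apply: contra_not nab => h i; by rewrite -le_iff.
  move=> nuv; apply/seteqP; split => // x xuv; apply: nuv => i.
  by have /andP[] := xuv i; exact: le_trans.
- by move=> n; exact: measure_box_fin.
Qed.

Lemma lebesgue_subl c (A : set (Rd R d)) : measurable A ->
  mu ((fun y : Rd R d => (c - (y : 'rV[R]_d) : Rd R d)) @^-1` A) = mu A.
Proof.
apply: lebesgue_preimage.
  exact: measurableT_comp (@measurable_subr R d) (pair1_measurable (c : Rd R d)).
move=> a b; exists (c - b), (c - a); split => [|i]; last by rewrite !mxE; lra.
by apply/seteqP; split => x /= h i; have := h i; rewrite !mxE => /andP[u v];
  apply/andP; split; lra.
Qed.

Lemma lebesgue_subr c (A : set (Rd R d)) : measurable A ->
  mu ((fun x : Rd R d => ((x : 'rV[R]_d) - c : Rd R d)) @^-1` A) = mu A.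
Proof.
apply: lebesgue_preimage.
  exact: measurableT_comp (@measurable_subr R d) (pair2_measurable (c : Rd R d)).
move=> a b; exists (a + c), (b + c); split => [|i]; last by rewrite !mxE; lra.
by apply/seteqP; split => x /= h i; have := h i; rewrite !mxE => /andP[u v];
  apply/andP; split; lra.
Qed.

Lemma integral_preimage (f : Rd R d -> Rd R d) (k : Rd R d -> \bar R) :
  measurable_fun setT f ->
  (forall A, measurable A -> mu (f @^-1` A) = mu A) ->
  measurable_fun setT k -> (forall x, 0 <= k x)%E ->
  (\int[mu]_y k (f y) = \int[mu]_y k y)%E.
Proof.
move=> mf hf mk k0.
pose mfB := isMeasurableFun.Build _ _ _ _ _ mf.
pose F : {mfun _ >-> _} := HB.pack f mfB.
have := @ge0_integral_pushforward _ _ _ _ R _ mf mu setT k measurableT mk.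
rewrite preimage_setT => /(_ (fun y _ => k0 y)) <-.
apply: eq_measure_integral => A mA _.
exact: hf.
Qed.

(** Tonelli with the inner integral over the second variable, which equals the total mass of [k] for
    every fixed first variable by [lebesgue_subl]. *)
Lemma integral_convl (h k : Rd R d -> R) :
  measurable_fun setT h -> measurable_fun setT k ->
  (forall x, 0 <= h x) -> (forall x, 0 <= k x) ->
  (\int[mu \x mu]_z (h z.1 * k ((z.1 : 'rV[R]_d) - (z.2 : 'rV[R]_d)))%:E =
   (\int[mu]_x (h x)%:E) * (\int[mu]_x (k x)%:E))%E.
Proof.
move=> mh mk h0 k0.
rewrite fubini_tonelli1; last 2 first.
- apply/measurable_EFinP; apply: measurable_funM.
    exact: measurableT_comp mh measurable_fst.
  exact: (measurableT_comp mk (@measurable_subr R d)).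
- by move=> z; rewrite lee_fin mulr_ge0.
rewrite -ge0_integralZr//; last 3 first.
- exact/measurable_EFinP.
- by move=> x _; rewrite lee_fin.
- by apply: integral_ge0 => x _; rewrite lee_fin.
apply: eq_integral => x _; rewrite /fubini_F /=.
under eq_integral do rewrite EFinM.
have mc : measurable_fun setT (fun y : Rd R d => ((x : 'rV[R]_d) - (y : 'rV[R]_d) : Rd R d)).
  exact: measurableT_comp (@measurable_subr R d) (pair1_measurable x).
rewrite ge0_integralZl//; last 3 first.
- by apply/measurable_EFinP; exact: measurableT_comp mk mc.
- by move=> y _; rewrite lee_fin.
- by rewrite lee_fin.
congr (_ * _)%E; apply: (integral_preimage mc (k := fun y => (k y)%:E)).
- by move=> A; exact: lebesgue_subl.
- exact/measurable_EFinP.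
- by move=> y; rewrite lee_fin.
Qed.

Lemma integral_convr (h k : Rd R d -> R) :
  measurable_fun setT h -> measurable_fun setT k ->
  (forall x, 0 <= h x) -> (forall x, 0 <= k x) ->
  (\int[mu \x mu]_z (h z.2 * k ((z.1 : 'rV[R]_d) - (z.2 : 'rV[R]_d)))%:E =
   (\int[mu]_x (h x)%:E) * (\int[mu]_x (k x)%:E))%E.
Proof.
move=> mh mk h0 k0.
rewrite fubini_tonelli2; last 2 first.
- apply/measurable_EFinP; apply: measurable_funM.
    exact: measurableT_comp mh measurable_snd.
  exact: (measurableT_comp mk (@measurable_subr R d)).
- by move=> z; rewrite lee_fin mulr_ge0.
rewrite -ge0_integralZr//; last 3 first.
- exact/measurable_EFinP.
- by move=> x _; rewrite lee_fin.
- by apply: integral_ge0 => x _; rewrite lee_fin.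
apply: eq_integral => y _; rewrite /fubini_G /=.
under eq_integral do rewrite EFinM.
have mc : measurable_fun setT (fun x : Rd R d => ((x : 'rV[R]_d) - (y : 'rV[R]_d) : Rd R d)).
  exact: measurableT_comp (@measurable_subr R d) (pair2_measurable y).
rewrite ge0_integralZl//; last 3 first.
- by apply/measurable_EFinP; exact: measurableT_comp mk mc.
- by move=> x _; rewrite lee_fin.
- by rewrite lee_fin.
congr (_ * _)%E; apply: (integral_preimage mc (k := fun y => (k y)%:E)).
- by move=> A; exact: lebesgue_subr.
- exact/measurable_EFinP.
- by move=> x; rewrite lee_fin.
Qed.

Lemma negligible_fst (P : Rd R d -> Prop) :
  {ae mu, forall x, P x} -> {ae (mu \x mu)%E, forall z, P z.1}.
Proof.
move=> [N [mN N0 subN]]; exists (N `*` setT); split.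
- exact: measurableX.
- by rewrite product_measure1E// [X in (X * _)%E](_ : _ = 0%E) ?mul0e.
- by move=> z /= nP; split => //; apply: subN.
Qed.

Lemma negligible_snd (P : Rd R d -> Prop) :
  {ae mu, forall x, P x} -> {ae (mu \x mu)%E, forall z, P z.2}.
Proof.
move=> [N [mN N0 subN]]; exists (setT `*` N); split.
- exact: measurableX.
- by rewrite product_measure1E// [X in (_ * X)%E](_ : _ = 0%E) ?mule0.
- by move=> z /= nP; split => //; apply: subN.
Qed.

(** The convolution identity with [h = 1] and [k] the indicator of the null set; the first factor
    may be infinite, but its product with 0 is 0. This carries a.e. statements about the kernel to
    the variable [x - y]. *)
Lemma negligible_sub (P : Rd R d -> Prop) : {ae mu, forall x, P x} ->
  {ae (mu \x mu)%E, forall z, P ((z.1 : 'rV[R]_d) - (z.2 : 'rV[R]_d))}.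
Proof.
move=> [N [mN N0 subN]].
pose s := fun z : Rd R d * Rd R d => ((z.1 : 'rV[R]_d) - (z.2 : 'rV[R]_d)) : Rd R d.
have mD : measurable (s @^-1` N).
  by rewrite -[X in measurable X]setTI; exact: measurable_subr.
exists (s @^-1` N); split => //; last by move=> z /= nP; apply: subN.
have I0 : (\int[mu]_x (\1_N x : R)%:E = 0)%E by rewrite integral_indic// setIT.
have := integral_convl (h := cst 1) (k := \1_N) (measurable_cst _)
  (measurable_indic mN) (fun _ => ler01).
rewrite I0 mule0 => /(_ (fun x => _)) <-; last by move=> x; rewrite indicE.
rewrite (eq_integral (fun z => (\1_(s @^-1` N) z)%:E)) ?integral_indic ?setIT//.
by move=> z _ /=; rewrite mul1r.
Qed.
End Lebesgue.

(** * Smooth bumps *)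

Section Bump.
Context (R : realType).

(** The classical flat function, with an additional power [t^-m] because differentiation raises that
    power: the family is stable under derivatives up to linear combinations. *)
Definition flat_exp (m : nat) (t : R) : R :=
  if 0 < t then t^-1 ^+ m * expR (- t^-1) else 0.

Lemma flat_exp_ge0 m t : 0 <= flat_exp m t.
Proof.
rewrite /flat_exp; case: ifP => // t0.
by rewrite mulr_ge0 ?expR_ge0// exprn_ge0// invr_ge0 ltW.
Qed.

(** For positive [t], keep one Taylor term: [exp(1/t) >= (1/t)^(m+2) / (m+2)!]. Quadratic decay is
    what makes the derivative at 0 vanish. *)
Lemma flat_exp_le_sqr m t : flat_exp m t <= (m.+2)`!%:R * t ^+ 2.
Proof.
rewrite /flat_exp; case: ifPn => t0; last by rewrite mulr_ge0// sqr_ge0.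
have ti : 0 <= t^-1 by rewrite invr_ge0 ltW.
have := expR_ge1Dxn m.+1 ti; rewrite expRN.
have : 0 < expR t^-1 by exact: expR_gt0.
move: (expR _) => e e0 le.
have {le} le : t^-1 ^+ m.+2 / (m.+2)`!%:R <= e by apply: le_trans le; rewrite lerDr.
have f0 : (0 : R) < (m.+2)`!%:R by rewrite ltr0n fact_gt0.
rewrite ler_pdivrMr//.
rewrite (_ : t^-1 ^+ m = (m.+2)`!%:R * t ^+ 2 * (t^-1 ^+ m.+2 / (m.+2)`!%:R)).
  by apply: ler_wpM2l le; apply: mulr_ge0; [exact: ltW|exact: sqr_ge0].
rewrite -addn2 exprD !exprVn.
by field; rewrite expf_neq0 ?gt_eqF.
Qed.

Lemma is_derive_flat_exp m (t : R) : is_derive t 1 (flat_exp m)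
  (flat_exp m.+2 t - m%:R * flat_exp m.+1 t).
Proof.
have [t0|t0|->] := ltgtP t 0.
- apply: (near_eq_is_derive (f := cst 0)).
    near=> s; rewrite /flat_exp ifF//; apply/negbTE; rewrite -leNgt ltW//.
    by near: s; exact: lt_nbhsl.
  apply: is_derive_eq.
  by rewrite /flat_exp ltNge (ltW t0) /= mulr0 subr0.
- apply: (near_eq_is_derive (f := (fun s : R => s^-1) ^+ m * (expR \o (fun s => - s^-1)))).
    near=> s; rewrite /flat_exp ifT ?fctE//.
    by near: s; exact: lt_nbhsr.
  have tn0 : t != 0 by rewrite gt_eqF.
  have di : is_derive t 1 (fun s : R => s^-1) (- t ^- 2).
    by apply: is_derive_eq (is_deriveV tn0 (is_derive_id t 1)) _; rewrite /GRing.scale /= mulr1.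
  apply: is_derive_eq.
  rewrite /flat_exp t0 /GRing.scale /= !fctE.
  case: m => [|m]; rewrite /= ?mulr0n !exprVn; first by field; lra.
  move: (expR _) (m.+1%:R : R) => E c; rewrite !exprS.
  by field; rewrite expf_neq0.
- rewrite /flat_exp ltxx mulr0 subr0.
  (* At 0 the difference quotient is at most [(m+2)! * |h|] in absolute value. *)
  have E : (fun h : R => h^-1 *: ((flat_exp m \o shift 0) (h *: 1) - flat_exp m 0)) @ 0^' --> (0 : R).
    apply/cvgr0Pnorm_lt => e e0.
    have C0 : (0 : R) < (m.+2)`!%:R by rewrite ltr0n fact_gt0.
    near=> h.
    have hn0 : h != 0 by near: h; exact: nbhs_dnbhs_neq.
    have he : `|h| < e / (m.+2)`!%:R.
      by near: h; apply: dnbhs0_lt; rewrite divr_gt0.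
    rewrite /= /GRing.scale /= addr0 mulr1 [flat_exp m 0]/flat_exp ltxx subr0.
    rewrite normrM normfV (ger0_norm (flat_exp_ge0 _ _)) mulrC ltr_pdivrMr ?normr_gt0//.
    apply: le_lt_trans (flat_exp_le_sqr m h) _.
    rewrite -(real_normK (num_real h)) expr2 mulrA ltr_pM2r ?normr_gt0//.
    by rewrite mulrC -ltr_pdivlMr.
  split; first by apply/cvg_ex; exists 0.
  by apply/cvg_lim.
Unshelve. all: by end_near. Qed.

Context (d : nat).
Implicit Types f g : 'rV[R]_d -> R.

(* An algebra of functions that is stable under directional derivatives. *)
Inductive bump_alg : ('rV[R]_d -> R) -> Prop :=
| bump_cst c : bump_alg (fun=> c)
| bump_flat m i k c : bump_alg (fun x => flat_exp m (k * x ord0 i + c))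
| bump_add f g : bump_alg f -> bump_alg g -> bump_alg (fun x => f x + g x)
| bump_mul f g : bump_alg f -> bump_alg g -> bump_alg (fun x => f x * g x).

Lemma is_derive_coord (x v : 'rV[R]_d) i :
  is_derive x v (fun y : 'rV[R]_d => y ord0 i) (v ord0 i).
Proof.
have @f : {linear 'rV[R]_d -> R}.
  by exists (fun N : 'M[R]_(_, _) => N ord0 i); do 2![eexists]; do ?[constructor];
     rewrite ?mxE// => ? *; rewrite ?mxE//; move=> ?; rewrite !mxE.
have dc : differentiable (fun y : 'rV[R]_d => y ord0 i) x.
  exact: differentiable_coord.
split; first exact: diff_derivable.
rewrite deriveE//.
have := @diff_lin _ _ _ f x; rewrite /f /= => -> //; exact: coord_continuous.
Qed.

Lemma flat_comp_diff m i (k c : R) (x v : 'rV[R]_d) :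
  differentiable (fun y : 'rV[R]_d => flat_exp m (k * y ord0 i + c)) x /\
  'D_v (fun y : 'rV[R]_d => flat_exp m (k * y ord0 i + c)) x =
    (k * v ord0 i) * (flat_exp m.+2 (k * x ord0 i + c)
                      - m%:R * flat_exp m.+1 (k * x ord0 i + c)).
Proof.
pose A := fun y : 'rV[R]_d => k * y ord0 i + c.
have dA : differentiable A x.
  apply: differentiableD; last exact: differentiable_cst.
  exact: (@differentiableZ _ _ _ (fun y : 'rV[R]_d => y ord0 i : R) k x (differentiable_coord _ _ _)).
have DA : 'D_v A x = k * v ord0 i.
  have h := @is_deriveZ _ _ _ (fun y : 'rV[R]_d => y ord0 i : R) k x v _ (is_derive_coord x v i).
  have h2 := is_deriveD h (is_derive_cst c x v).
  by rewrite -[RHS]addr0; exact: (@derive_val _ _ _ _ _ _ _ h2).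
have dE := is_derive_flat_exp m (A x).
have dE' : differentiable (flat_exp m) (A x) by apply/derivable1_diffP; case: dE.
split; first exact: (differentiable_comp dA dE').
rewrite deriveE; last exact: (differentiable_comp dA dE').
rewrite (diff_comp dA dE') /= deriv1E; last by case: dE.
by rewrite -(deriveE v dA) DA derive1E (@derive_val _ _ _ _ _ _ _ dE).
Qed.

Lemma bump_alg_diff f : bump_alg f ->
  (forall x, differentiable f x) /\ forall v, bump_alg ('D_v f).
Proof.
elim=> [c|m i k c|{}f g hf [df Df] hg [dg Dg]|{}f g hf [df Df] hg [dg Dg]].
- split=> [x|v]; first exact: differentiable_cst.
  rewrite (_ : 'D_v _ = fun=> 0); first exact: bump_cst.
  by apply/funext => x; rewrite derive_cst.
- split=> [x|v]; first by have [] := flat_comp_diff m i k c x 0.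
  rewrite (_ : 'D_v _ = fun x => (k * v ord0 i) * (flat_exp m.+2 (k * x ord0 i + c)
                      + (- m%:R) * flat_exp m.+1 (k * x ord0 i + c))).
    apply: bump_mul; first exact: bump_cst.
    apply: bump_add; first exact: bump_flat.
    by apply: bump_mul; [exact: bump_cst|exact: bump_flat].
  by apply/funext => x; rewrite (flat_comp_diff m i k c x v).2 mulNr.
- split=> [x|v]; first exact: differentiableD.
  rewrite (_ : 'D_v _ = fun x => 'D_v f x + 'D_v g x); first exact: bump_add.
  by apply/funext => x; rewrite deriveD//; exact: diff_derivable.
- split=> [x|v]; first exact: differentiableM.
  rewrite (_ : 'D_v _ = fun x => f x * 'D_v g x + g x * 'D_v f x).
    by apply: bump_add; exact: bump_mul.
  by apply/funext => x; rewrite deriveM//; exact: diff_derivable.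
Qed.

Lemma bump_alg_smooth f : bump_alg f -> smooth f.
Proof.
move=> + k; elim: k f => [|k IH] f hf /=.
  by move=> x; apply: differentiable_continuous; exact: (bump_alg_diff hf).1.
by split; [exact: (bump_alg_diff hf).1|move=> v; apply: IH; exact: (bump_alg_diff hf).2].
Qed.

(** Inside the open box, with [N = n+1], the factor for coordinate [i] is [exp(-1/(N(x_i-a_i))) *
    exp(-1/(N(b_i-x_i)))], which tends to 1 as [N] grows. The arguments are expanded as
    [k * x_i + c] to match [bump_flat]. *)
Definition bump (a b : 'rV[R]_d) (n : nat) (x : 'rV[R]_d) : R :=
  \prod_(i < d) (flat_exp 0 (n.+1%:R * x ord0 i - n.+1%:R * a ord0 i) *
                 flat_exp 0 (- n.+1%:R * x ord0 i + n.+1%:R * b ord0 i)).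

Lemma bump_alg_bump a b n : bump_alg (bump a b n).
Proof.
rewrite (_ : bump a b n = fun x => \prod_(i <- index_enum 'I_d)
    (flat_exp 0 (n.+1%:R * x ord0 i + - (n.+1%:R * a ord0 i)) *
     flat_exp 0 (- n.+1%:R * x ord0 i + n.+1%:R * b ord0 i)))//.
elim: (index_enum _) => [|i s IH].
  rewrite (_ : (fun _ => _) = fun=> 1); first exact: bump_cst.
  by apply/funext => x; rewrite big_nil.
have := bump_mul (bump_mul (bump_flat 0 i n.+1%:R (- (n.+1%:R * a ord0 i)))
  (bump_flat 0 i (- n.+1%:R) (n.+1%:R * b ord0 i))) IH.
by congr bump_alg; apply/funext => x; rewrite big_cons.
Qed.

Lemma flat_exp_le1 t : flat_exp 0 t <= 1.
Proof.
rewrite /flat_exp expr0 mul1r; case: ifP => // t0.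
by rewrite -expR0 ler_expR oppr_le0 invr_ge0 ltW.
Qed.

Lemma bump_ge0 a b n x : 0 <= bump a b n x.
Proof. by apply: prodr_ge0 => i _; rewrite mulr_ge0 ?flat_exp_ge0. Qed.

Lemma bump_le1 a b n x : bump a b n x <= 1.
Proof.
apply: Num.Theory.prodr_ile1 => i _.
rewrite mulr_ge0 ?flat_exp_ge0//=.
by rewrite mulr_ile1 ?flat_exp_ge0 ?flat_exp_le1.
Qed.

Lemma bump_out a b n x : ~ obox a b x -> bump a b n x = 0.
Proof.
move=> /existsNP[i /negP]; rewrite negb_and -!leNgt => h.
apply/eqP; rewrite prodf_seq_eq0; apply/hasP; exists i; first by rewrite mem_index_enum.
rewrite /= mulf_eq0 /flat_exp; apply/orP.
have n0 : (0 : R) < n.+1%:R by rewrite ltr0n.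
have /orP[h'|h'] := h; [left|right]; rewrite ifF//; apply/negbTE; rewrite -leNgt.
- by rewrite -mulrBr pmulr_rle0// subr_le0.
- by rewrite mulNr addrC -mulrBr pmulr_rle0// subr_le0.
Qed.

Lemma flat_exp_cvg (t : R) : 0 < t -> (fun n => flat_exp 0 (n.+1%:R * t)) @ \oo --> (1 : R).
Proof.
move=> t0; rewrite (_ : (fun _ => _) = fun n => expR (- (n.+1%:R^-1 * t^-1))); last first.
  by apply/funext => n; rewrite /flat_exp expr0 mul1r mulr_gt0 ?ltr0n// invfM.
have h : (fun n : nat => - (n.+1%:R^-1 * t^-1)) @ \oo --> (0 : R).
  rewrite -oppr0; apply: cvgN; rewrite -[X in _ --> X](mul0r t^-1).
  by apply: cvgM; [exact: (@cvg_harmonic R)|exact: cvg_cst].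
rewrite -[X in _ --> X]expR0.
exact: (continuous_cvg _ (@continuous_expR R 0) h).
Qed.

Lemma bump_cvg a b x : obox a b x -> bump a b ^~ x @ \oo --> (1 : R).
Proof.
move=> xab; rewrite /bump; elim: (index_enum _) => [|i s IH].
  by under eq_fun do rewrite big_nil; exact: cvg_cst.
have /andP[ax xb] := xab i.
have ha : (fun n => flat_exp 0 (n.+1%:R * x ord0 i - n.+1%:R * a ord0 i)) @ \oo --> (1 : R).
  under eq_fun do rewrite -mulrBr.
  by apply: flat_exp_cvg; rewrite subr_gt0.
have hb : (fun n => flat_exp 0 (- n.+1%:R * x ord0 i + n.+1%:R * b ord0 i)) @ \oo --> (1 : R).
  under eq_fun do rewrite mulNr addrC -mulrBr.
  by apply: flat_exp_cvg; rewrite subr_gt0.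
under eq_fun do rewrite big_cons.
by have := cvgM (cvgM ha hb) IH; rewrite !mulr1; apply.
Qed.
End Bump.

(** * A countable family of test functions *)

Section CountableFamily.
Context (R : realType) (d : nat) (Om : set 'rV[R]_d).

Definition atom : Type := (('rV[rat]_d * 'rV[rat]_d * nat) + rat)%type.

(** Trees over a countable set of atoms form a countable type, so the functions they denote form a
    countable set. [Node 0] is the imaginary unit, [Node 1] a sum, higher labels products; other
    shapes default to 0. *)
Fixpoint expr_eval (t : GenTree.tree atom) : 'rV[R]_d -> R[i] :=
  match t with
  | GenTree.Leaf (inl (a, b, n)) =>
      fun x => Complex (bump (map_mx ratr a) (map_mx ratr b) n x) 0
  | GenTree.Leaf (inr q) => fun _ => Complex (ratr q) 0
  | GenTree.Node 0 _ => fun _ => Complex 0 1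
  | GenTree.Node 1 [:: t1; t2] => fun x => expr_eval t1 x + expr_eval t2 x
  | GenTree.Node _ [:: t1; t2] => fun x => expr_eval t1 x * expr_eval t2 x
  | _ => fun _ => 0
  end.

Lemma expr_eval_bump_alg t : bump_alg (fun x => complex.Re (expr_eval t x)) /\
  bump_alg (fun x => complex.Im (expr_eval t x)).
Proof.
have add (f g : 'rV[R]_d -> R[i]) :
  bump_alg (fun x => complex.Re (f x)) /\ bump_alg (fun x => complex.Im (f x)) ->
  bump_alg (fun x => complex.Re (g x)) /\ bump_alg (fun x => complex.Im (g x)) ->
  bump_alg (fun x => complex.Re (f x + g x)) /\ bump_alg (fun x => complex.Im (f x + g x)).
  move=> [fr fi] [gr gi]; split.
    have := bump_add fr gr; congr bump_alg.
    by apply/funext => x; case: (f x) (g x) => [? ?] [].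
  have := bump_add fi gi; congr bump_alg.
  by apply/funext => x; case: (f x) (g x) => [? ?] [].
have mul (f g : 'rV[R]_d -> R[i]) :
  bump_alg (fun x => complex.Re (f x)) /\ bump_alg (fun x => complex.Im (f x)) ->
  bump_alg (fun x => complex.Re (g x)) /\ bump_alg (fun x => complex.Im (g x)) ->
  bump_alg (fun x => complex.Re (f x * g x)) /\ bump_alg (fun x => complex.Im (f x * g x)).
  move=> [fr fi] [gr gi]; split.
    have := bump_add (bump_mul fr gr) (bump_mul (bump_cst d (-1)) (bump_mul fi gi)).
    congr bump_alg; apply/funext => x.
    by case: (f x) (g x) => [? ?] [? ?] /=; rewrite mulN1r.
  have := bump_add (bump_mul fr gi) (bump_mul fi gr).
  congr bump_alg; apply/funext => x.
  by case: (f x) (g x) => [? ?] [].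
have c0 : bump_alg (fun _ : 'rV[R]_d => 0 : R) by exact: bump_cst.
(* The recursion is written by hand because subtrees are reached through the list of children. *)
move: t; fix IH 1 => -[[[[a b] n]|q]|n s] /=.
- by split => //; exact: bump_alg_bump.
- by split => //; exact: bump_cst.
- case: n => [|[|n]].
  + by split => //; exact: bump_cst.
  + by case: s => [//|t1 [//|t2 [|//]]]; apply: add; exact: IH.
  + by case: s => [//|t1 [//|t2 [|//]]]; apply: mul; exact: IH.
Qed.

Definition supp_in (V : nmodType) (g : 'rV[R]_d -> V) : Prop :=
  exists K : set 'rV[R]_d, compact K /\ K `<=` Om /\ forall x, ~ K x -> g x = 0.

Lemma supp_in_closure (g : 'rV[R]_d -> R[i]) : supp_in g <->
  compact (closure [set x | g x != 0]) /\ closure [set x | g x != 0] `<=` Om.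
Proof.
split=> [[K [cK [KOm gK]]]|[cg gOm]]; last first.
  exists (closure [set x | g x != 0]); split => //; split => // x nx.
  by apply: contrapT => /eqP gx; apply: nx; exact: subset_closure.
have clK : closed K by apply: compact_closed => //; exact: norm_hausdorff.
have sub : closure [set x | g x != 0] `<=` K.
  rewrite [X in _ `<=` X](_ : K = closure K); last exact/closure_id.
  apply: closureS => x /= gx.
  by apply: contrapT => /gK /eqP; exact/negP.
split; last exact: subset_trans KOm.
by apply: subclosed_compact cK sub; exact: closed_closure.
Qed.

(** The support condition is put on the denoted function and not on the tree: constants are needed
    as multipliers although they need not have compact support in [Om]. *)
Definition dense_fam : set ('rV[R]_d -> R[i]) :=
  [set g | (exists t, g = expr_eval t) /\ supp_in g].

Lemma dense_fam_countable : countable dense_fam.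
Proof.
apply: (@sub_countable _ _ _ (expr_eval @` setT)).
  by apply: subset_card_le => g [[t ->] _]; exists t.
by apply: sub_countable (card_image_le _ _) _; exact: countableP.
Qed.

Lemma dense_fam_C0inf : dense_fam `<=` C0inf Om.
Proof.
move=> g [[t gt] sg]; have [re im] := expr_eval_bump_alg t.
split; first by rewrite gt; exact: bump_alg_smooth.
split; first by rewrite gt; exact: bump_alg_smooth.
exact/supp_in_closure.
Qed.

(** Approximation is carried out on real and imaginary parts separately; [dense_fam_complex]
    recombines them with the tree for the imaginary unit. *)
Definition dense_real : set ('rV[R]_d -> R) :=
  [set v | (exists t, forall x, expr_eval t x = Complex (v x) 0) /\ supp_in v].

Lemma dense_real_continuous v : dense_real v -> continuous v.
Proof.
move=> [[t tv] _].
have := (expr_eval_bump_alg t).1; rewrite (_ : (fun _ => _) = v).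
  by move/bump_alg_smooth => /(_ 0%N).
by apply/funext => x; rewrite tv.
Qed.

Lemma dense_real_measurable v : dense_real v -> measurable_fun setT (v : Rd R d -> R).
Proof. by move=> /dense_real_continuous; exact: continuous_measurable_Rd. Qed.

Lemma dense_real0 : dense_real (fun=> 0).
Proof.
split; first by exists (GenTree.Leaf (inr 0)) => x /=; rewrite rmorph0.
by exists set0; split; [exact: compact0|split].
Qed.

Lemma dense_realD v w : dense_real v -> dense_real w -> dense_real (fun x => v x + w x).
Proof.
move=> [[t tv] [K [cK [KO vK]]]] [[s sw] [L [cL [LO wL]]]]; split.
  by exists (GenTree.Node 1 [:: t; s]) => x /=; rewrite tv sw; apply/eqP; rewrite eq_complex /= addr0 !eqxx.
exists (K `|` L); split; first exact: compactU.
split; first by rewrite subUset.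
by move=> x /not_orP[/vK -> /wL ->]; rewrite addr0.
Qed.

Lemma dense_realM v w : dense_real v -> dense_real w -> dense_real (fun x => v x * w x).
Proof.
move=> [[t tv] [K [cK [KO vK]]]] [[s sw] [L [cL [LO wL]]]]; split.
  by exists (GenTree.Node 2 [:: t; s]) => x /=; rewrite tv sw; apply/eqP;
    rewrite eq_complex /= !mulr0 mul0r subr0 addr0 !eqxx.
by exists K; split => //; split => // x /vK ->; rewrite mul0r.
Qed.

Lemma dense_realZ q v : dense_real v -> dense_real (fun x => ratr q * v x).
Proof.
move=> [[t tv] [K [cK [KO vK]]]]; split.
  by exists (GenTree.Node 2 [:: GenTree.Leaf (inr q); t]) => x /=; rewrite tv; apply/eqP;
    rewrite eq_complex /= !mulr0 mul0r subr0 addr0 !eqxx.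
by exists K; split => //; split => // x /vK ->; rewrite mulr0.
Qed.

Lemma dense_realB v w : dense_real v -> dense_real w -> dense_real (fun x => v x - w x).
Proof.
move=> dv /(dense_realZ (-1)) /(dense_realD dv); congr dense_real.
by apply/funext => x; rewrite rmorphN rmorph1 mulN1r.
Qed.

Lemma dense_real_bump (a b : 'rV[rat]_d) n :
  box (map_mx ratr a) (map_mx ratr b) `<=` Om ->
  dense_real (bump (map_mx ratr a) (map_mx ratr b) n).
Proof.
move=> abO; split; first by exists (GenTree.Leaf (inl (a, b, n))).
exists (box (map_mx ratr a) (map_mx ratr b)); split; first exact: compact_box.
split => // x nx; apply: bump_out; apply: contra_not nx; exact: obox_sub_box.
Qed.

Lemma dense_fam_complex v w : dense_real v -> dense_real w ->
  dense_fam (fun x => Complex (v x) (w x)).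
Proof.
move=> [[t tv] [K [cK [KO vK]]]] [[s sw] [L [cL [LO wL]]]]; split.
  exists (GenTree.Node 1 [:: t; GenTree.Node 2 [:: GenTree.Node 0 [::]; s]]).
  apply/funext => x /=; rewrite tv sw; apply/eqP.
  by rewrite eq_complex /= !mulr0 !mul0r mul1r subr0 addr0 !add0r !eqxx.
exists (K `|` L); split; first exact: compactU.
split; first by rewrite subUset.
by move=> x /not_orP[/vK -> /wL ->].
Qed.
End CountableFamily.

(** * Approximation of sets of finite measure by test functions *)

Section ApproxSets.
Context (R : realType) (d : nat) (Om : set 'rV[R]_d) (oOm : open Om).
Context (mu : {sigma_finite_measure set (Rd R d) -> \bar R}).
Hypothesis hmu : is_lebesgue mu.
Implicit Types A B : set (Rd R d).

(** The range [0,1] belongs to the notion: there the polynomial versions of Boolean operations do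
    not amplify errors, and [theta] is bounded by a linear function. *)
Definition approx_set A : Prop := measurable A /\
  forall e : R, 0 < e -> exists v : 'rV[R]_d -> R, dense_real Om v /\
    (forall x, 0 <= v x <= 1) /\
    (\int[mu]_x (`|\1_A x - v x|)%:E < e%:E)%E.

Lemma measurable_indic_sub A (v : 'rV[R]_d -> R) : measurable A ->
  measurable_fun setT (v : Rd R d -> R) ->
  measurable_fun setT (fun x : Rd R d => `|\1_A x - v x|).
Proof.
move=> mA mv; apply: measurableT_comp; first exact: normr_measurable.
exact: measurable_funB.
Qed.

Lemma approx_set0 : approx_set set0.
Proof.
split => // e e0; exists (fun=> 0); split; first exact: dense_real0.
split; first by move=> x; rewrite lexx ler01.
by rewrite integral0_eq ?lte_fin// => x _; rewrite indic0 subr0 normr0.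
Qed.

Lemma approx_obox (a b : 'rV[rat]_d) :
  box (map_mx ratr a) (map_mx ratr b) `<=` Om ->
  approx_set (obox (map_mx ratr a) (map_mx ratr b)).
Proof.
set a' := map_mx _ a; set b' := map_mx _ b => abO.
have mo : measurable (obox a' b' : set (Rd R d)).
  rewrite (_ : obox a' b' = \bigcap_(i in [set: 'I_d])
    ((fun t : Rd R d => (t : 'rV[R]_d) ord0 i) @^-1` `]a' ord0 i, b' ord0 i[%classic)).
    apply: fin_bigcap_measurable => // i _.
    by rewrite -[X in measurable X]setTI; apply: measurable_coord.
  apply/seteqP; split => t /= h i; last by have := h i I; rewrite /= in_itv.
  by move=> _ /=; have := h i; rewrite in_itv.
split => // e e0.
have [n hn] : exists n, (\int[mu]_x (`|\1_(obox a' b') x - bump a' b' n x|)%:E < e%:E)%E.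
  (* The majorant is the indicator of the closed box, which has finite measure; bumps vanish off the
     open box. *)
  apply: (@dominated_small _ _ _ mu
    (fun n (x : Rd R d) => `|\1_(obox a' b') x - bump a' b' n x|) \1_(box a' b')) => //.
  - by move=> n; apply: measurable_indic_sub => //; apply: (@dense_real_measurable _ _ Om);
      exact: dense_real_bump.
  - by apply: measurable_indic; exact: measurable_box.
  - move=> n x; rewrite normr_ge0 /= !indicE.
    have b0 := bump_ge0 a' b' n x; have b1 := bump_le1 a' b' n x.
    case: (boolP (x \in obox a' b')) => [|/negP].
      rewrite inE => xo; rewrite (mem_set (obox_sub_box xo)) /= !mulr1n.
      by rewrite ger0_norm; lra.
    by rewrite inE => nx; rewrite bump_out// subr0 normr0.
  - move=> x; have [xo|nx] := pselect (obox a' b' x); last first.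
      rewrite (_ : (fun _ => _) = fun=> 0); first exact: cvg_cst.
      by apply/funext => n; rewrite bump_out// indicE memNset// subr0 normr0.
    under eq_fun do rewrite indicE mem_set//.
    rewrite -(@normr0 _ R) -(subrr (1 : R)); apply: cvg_norm; apply: cvgB; first exact: cvg_cst.
    exact: bump_cvg.
  - rewrite integral_indic ?setIT//; last exact: measurable_box.
    exact: measure_box_fin.
exists (bump a' b' n); split; first exact: dense_real_bump.
by split => // x; rewrite bump_ge0 bump_le1.
Qed.

(** Common pattern of the three Boolean operations: [op] reproduces [\1_C] from the indicators of
    [A] and [B] and adds up errors without enlarging them, so [e / 2] for each set suffices. *)
Lemma approx_set_op A B C (op : R -> R -> R) :
  (forall v w, dense_real Om v -> dense_real Om w -> dense_real Om (fun x => op (v x) (w x))) ->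
  (forall s t, 0 <= s <= 1 -> 0 <= t <= 1 -> 0 <= op s t <= 1) ->
  (forall s t (x : Rd R d), 0 <= s <= 1 -> 0 <= t <= 1 ->
     `|\1_C x - op s t| <= `|\1_A x - s| + `|\1_B x - t| :> R) ->
  measurable C -> approx_set A -> approx_set B -> approx_set C.
Proof.
move=> dop op01 opC mC [mA hA] [mB hB]; split => // e e0.
have e20 : 0 < e / 2 by lra.
have [v [dv [v01 hv]]] := hA _ e20; have [w [dw [w01 hw]]] := hB _ e20.
exists (fun x => op (v x) (w x)); split; first exact: dop.
split; first by move=> x; exact: op01.
have mv := dense_real_measurable dv; have mw := dense_real_measurable dw.
apply: (@le_lt_trans _ _ (\int[mu]_x ((`|\1_A x - v x|)%:E + (`|\1_B x - w x|)%:E))%E).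
  apply: le_integral_ae.
  - by move=> x _; rewrite lee_fin.
  - by move=> x _; rewrite -EFinD lee_fin addr_ge0.
  - by apply: aeW => x _; rewrite -EFinD lee_fin; exact: opC.
rewrite ge0_integralD//; last 2 first.
- by apply/measurable_EFinP; exact: measurable_indic_sub.
- by apply/measurable_EFinP; exact: measurable_indic_sub.
by rewrite (splitr e) EFinD; exact: lteD.
Qed.

Lemma approx_setI A B : approx_set A -> approx_set B -> approx_set (A `&` B).
Proof.
move=> hA hB; apply: (approx_set_op (op := fun s t => s * t) _ _ _ _ hA hB).
- by move=> v w; exact: dense_realM.
- by move=> s t /andP[s0 s1] /andP[t0 t1]; rewrite mulr_ge0//= mulr_ile1.
- move=> s t x /andP[s0 s1] /andP[t0 t1]; rewrite !indicE in_setI.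
  (* These sign facts make the four cases linear in [s], [t] and [s * t]. *)
  have st0 : 0 <= s * t by rewrite mulr_ge0.
  have st1 : s * t <= s by rewrite ler_piMr.
  have st2 : s * t <= t by rewrite ler_piMl.
  have st3 : 0 <= (1 - s) * (1 - t) by rewrite mulr_ge0// subr_ge0.
  by case: (x \in A); case: (x \in B); rewrite /= ?mulr1n ?mulr0n ?sub0r ?normrN;
    rewrite !ger0_norm; lra.
- by apply: measurableI; [case: hA|case: hB].
Qed.

Lemma approx_setD A B : approx_set A -> approx_set B -> approx_set (A `\` B).
Proof.
move=> hA hB; apply: (approx_set_op (op := fun s t => s - s * t) _ _ _ _ hA hB).
- by move=> v w dv dw; apply: dense_realB => //; exact: dense_realM.
- by move=> s t /andP[s0 s1] /andP[t0 t1]; apply/andP; split; nra.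
- move=> s t x /andP[s0 s1] /andP[t0 t1]; rewrite !indicE in_setD.
  have st0 : 0 <= s * t by rewrite mulr_ge0.
  have st1 : s * t <= s by rewrite ler_piMr.
  have st2 : s * t <= t by rewrite ler_piMl.
  have st3 : 0 <= (1 - s) * (1 - t) by rewrite mulr_ge0// subr_ge0.
  by case: (x \in A); case: (x \in B); rewrite /= ?mulr1n ?mulr0n ?sub0r ?normrN;
    rewrite !ger0_norm; lra.
- by apply: measurableD; [case: hA|case: hB].
Qed.

Lemma approx_setU A B : approx_set A -> approx_set B -> approx_set (A `|` B).
Proof.
move=> hA hB; apply: (approx_set_op (op := fun s t => s + t - s * t) _ _ _ _ hA hB).
- by move=> v w dv dw; apply: dense_realB; [exact: dense_realD|exact: dense_realM].
- by move=> s t /andP[s0 s1] /andP[t0 t1]; apply/andP; split; nra.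
- move=> s t x /andP[s0 s1] /andP[t0 t1]; rewrite !indicE in_setU.
  have st0 : 0 <= s * t by rewrite mulr_ge0.
  have st1 : s * t <= s by rewrite ler_piMr.
  have st2 : s * t <= t by rewrite ler_piMl.
  have st3 : 0 <= (1 - s) * (1 - t) by rewrite mulr_ge0// subr_ge0.
  by case: (x \in A); case: (x \in B); rewrite /= ?mulr1n ?mulr0n ?sub0r ?normrN;
    rewrite !ger0_norm; lra.
- by apply: measurableU; [case: hA|case: hB].
Qed.

(** Finite measure makes [\1_U] an integrable majorant of the remainders left by finite unions; an
    approximant of one finite union with small remainder serves for the whole union. *)
Lemma approx_bigcup (F : nat -> set (Rd R d)) : (forall n, approx_set (F n)) ->
  (mu (\bigcup_n F n) < +oo)%E -> approx_set (\bigcup_n F n).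
Proof.
move=> hF fin; set U := \bigcup_n F n.
have mU : measurable U by apply: bigcupT_measurable => n; have [] := hF n.
split => // e e0; have e20 : 0 < e / 2 by lra.
pose G n := \big[setU/set0]_(i < n) F i.
have hG n : approx_set (G n).
  by rewrite /G; elim/big_ind : _ => //; [exact: approx_set0|exact: approx_setU].
have GU n : G n `<=` U.
  by rewrite /G -bigcup_mkord => x [k _ Fx]; exists k.
have [n hn] : exists n, (\int[mu]_x (\1_(U `\` G n) x)%:E < (e / 2)%:E)%E.
  apply: (@dominated_small _ _ _ mu (fun n => \1_(U `\` G n)) \1_U) => //.
  - by move=> n; apply: measurable_indic; apply: measurableD => //; have [] := hG n.
  - move=> n x; rewrite !indicE in_setD.
    by case: (x \in U); case: (x \in G n); rewrite /= ?lexx ?ler01.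
  - move=> x; have [[k _ Fx]|nU] := pselect (U x).
      apply: cvg_near_cst; near=> n.
      rewrite indicE memNset// => -[_]; apply; rewrite /G -bigcup_mkord.
      by exists k => //=; near: n; exact: nbhs_infty_gt.
    rewrite (_ : (fun _ => _) = fun=> 0); first exact: cvg_cst.
    by apply/funext => n; rewrite indicE memNset// => -[].
  - by rewrite integral_indic// setIT.
have [mG /(_ _ e20)[v [dv [v01 hv]]]] := hG n.
exists v; split => //; split => //.
have mv := dense_real_measurable dv.
apply: (@le_lt_trans _ _ (\int[mu]_x ((\1_(U `\` G n) x)%:E + (`|\1_(G n) x - v x|)%:E))%E).
  apply: le_integral_ae.
  - by move=> x _; rewrite lee_fin.
  - by move=> x _; rewrite -EFinD lee_fin addr_ge0// indicE.
  - apply: aeW => x _; rewrite -EFinD lee_fin !indicE in_setD.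
    have := v01 x; case: (boolP (x \in G n)) => [/set_mem /GU xU|_].
      by rewrite mem_set//= add0r.
    by case: (x \in U) => /= /andP[? ?]; rewrite ?sub0r ?normrN !ger0_norm//; lra.
rewrite ge0_integralD//; last 2 first.
- by apply/measurable_EFinP; apply: measurable_indic; exact: measurableD.
- by apply/measurable_EFinP; exact: measurable_indic_sub.
by rewrite (splitr e) EFinD; exact: lteD.
Unshelve. all: by end_near. Qed.

(** Inside the box [Q] all measures are finite, so the sets with approximable trace on [Q] form a
    sigma-algebra: complements become differences from [Q], and countable unions pass by
    [approx_bigcup]. *)
Lemma approx_obox_trace (a b : 'rV[rat]_d) A :
  box (map_mx ratr a) (map_mx ratr b) `<=` Om -> measurable A ->
  approx_set (A `&` obox (map_mx ratr a) (map_mx ratr b)).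
Proof.
move=> abO mA; have := approx_obox abO; set Q := obox _ _ => hQ.
have Qfin B : measurable B -> B `<=` Q -> (mu B < +oo)%E.
  move=> mB BQ; apply: le_lt_trans (measure_box_fin hmu (map_mx ratr a) (map_mx ratr b)).
  apply: le_measure; rewrite ?inE//; first exact: measurable_box.
  by apply: subset_trans BQ _; exact: obox_sub_box.
suff : @measurable _ (Rd R d) `<=` [set A | approx_set (A `&` Q)] by apply.
apply: smallest_sub; first split.
- by rewrite /= set0I; exact: approx_set0.
- move=> B /= hB; rewrite (_ : _ `&` Q = Q `\` (B `&` Q)); first exact: approx_setD.
  apply/seteqP; split => x /=.
    by move=> [[_ nB] Qx]; split => // -[].
  by move=> [Qx nBQ]; split => //; split => // Bx; apply: nBQ.
- move=> F /= hF; rewrite setI_bigcupl; apply: approx_bigcup => //.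
  apply: Qfin; first by apply: bigcupT_measurable => n; have [] := hF n.
  by move=> x [n _ []].
- move=> U oU /=.
  (* Intersecting with [Om] makes the boxes admissible, and loses no point of [U] in [Q] because [Q]
     lies in [Om]. *)
  have [F [hF FU]] := open_bigcup_boxes (openI oU oOm).
  have -> : U `&` Q = \bigcup_n (F n `&` Q).
    rewrite -setI_bigcupl FU; apply/seteqP; split => x /=; last by move=> [[]].
    by move=> [Ux Qx]; split => //; split => //; apply/abO/obox_sub_box.
  have hFQ n : approx_set (F n `&` Q).
    apply: approx_setI => //; have [->|[a' [b' [-> abU]]]] := hF n.
      exact: approx_set0.
    by apply: approx_obox => x /abU [].
  apply: approx_bigcup => //; apply: Qfin; last by move=> x [n _ []].
  by apply: bigcupT_measurable => n; have [] := hFQ n.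
Qed.

Lemma approx_set_measurable A : measurable A -> A `<=` Om -> (mu A < +oo)%E ->
  approx_set A.
Proof.
move=> mA AO fin; have [F [hF FO]] := open_bigcup_boxes oOm.
have AE : A = \bigcup_n (A `&` F n).
  by rewrite -setI_bigcupr FO setIidl.
rewrite AE; apply: approx_bigcup; last by rewrite -AE.
move=> n; have [->|[a [b [-> abO]]]] := hF n.
  by rewrite setI0; exact: approx_set0.
exact: approx_obox_trace.
Qed.
End ApproxSets.

(** * Approximation in the modular *)

Section Modular.
Context (R : realType) (pm pp : R) (hpm : 1 < pm) (hpmpp : pm <= pp).
Implicit Types s t : R.

Lemma powR_le p s t : 0 <= p -> 0 <= s -> s <= t -> s `^ p <= t `^ p.
Proof.
move=> p0 s0 st; apply: ge0_ler_powR => //; rewrite nnegrE//.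
exact: le_trans s0 st.
Qed.

(** The sum of the two powers covers small and large [t] without case distinction. Its first summand
    also lets the modular control the [L_pm] norm. *)
Definition theta t : R := t `^ pm + t `^ pp.

Lemma theta_ge0 t : 0 <= theta t.
Proof. by rewrite addr_ge0 ?powR_ge0. Qed.

Lemma theta0 : theta 0 = 0.
Proof.
have pm1 := hpm; have pmp := hpmpp; have pp0 : 0 < pp by lra.
have pm0 : 0 < pm by lra.
by rewrite /theta !powR0 ?addr0 ?gt_eqF.
Qed.

Lemma theta_le s t : 0 <= s -> s <= t -> theta s <= theta t.
Proof.
have pm1 := hpm; have pmp := hpmpp.
move=> s0 st; have t0 := le_trans s0 st.
by apply: lerD; apply: powR_le => //; lra.
Qed.

Lemma theta_scale c t : 0 <= c -> 0 <= t ->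
  theta (c * t) <= Num.max 1 c `^ pp * theta t.
Proof.
have pm1 := hpm; have pmp := hpmpp.
move=> c0 t0; have m1 : 1 <= Num.max 1 c by rewrite le_max lexx.
have mc : c <= Num.max 1 c by rewrite le_max lexx orbT.
have m0 : 0 <= Num.max 1 c by lra.
have cpp : c `^ pp <= Num.max 1 c `^ pp by apply: powR_le; lra.
have cpm : c `^ pm <= Num.max 1 c `^ pp.
  by apply: le_trans (ler_powR m1 hpmpp); apply: powR_le; lra.
by rewrite /theta !powRM// mulrDr lerD// ler_wpM2r// powR_ge0.
Qed.

Lemma theta_add s t : 0 <= s -> 0 <= t ->
  theta (s + t) <= 2 `^ pp * (theta s + theta t).
Proof.
move=> s0 t0; have M0 : 0 <= Num.max s t by rewrite le_max s0.
have st : s + t <= 2 * Num.max s t.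
  by rewrite mulr_natl mulr2n lerD// le_max lexx ?orbT.
apply: le_trans (theta_le _ st) _; first lra.
apply: le_trans (theta_scale _ M0) _ => //.
rewrite (_ : Num.max 1 2 = 2); last by apply/max_idPr; lra.
rewrite ler_wpM2l ?powR_ge0//.
by have [_|_] := leP s t; [rewrite lerDr|rewrite lerDl]; exact: theta_ge0.
Qed.

Lemma theta_le_lin t : 0 <= t <= 1 -> theta t <= 2 * t.
Proof.
have pm1 := hpm; have pmp := hpmpp.
move=> /andP[]; rewrite le_eqVlt => /predU1P[<- _|t0 t1].
  by rewrite theta0 mulr0.
by rewrite mulr_natl mulr2n; apply: lerD; apply: ge1r_powR; rewrite ?t0//; lra.
Qed.

(** For values at most [M] the higher power is absorbed into the lower one, so a bounded function of
    class [L_pm] has finite modular. *)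
Lemma theta_bounded M t : 1 <= M -> 0 <= t <= M -> theta t <= 2 * M `^ pp * t `^ pm.
Proof.
have pm1 := hpm; have pmp := hpmpp.
move=> M1 /andP[]; rewrite le_eqVlt => /predU1P[<- _|t0 tM].
  by rewrite theta0 mulr_ge0 ?mulr_ge0 ?powR_ge0.
have h1 : t `^ pm <= M `^ pp * t `^ pm.
  by rewrite ler_peMl ?powR_ge0// -[leLHS](powRr0 M); apply: ler_powR => //; lra.
have h2 : t `^ pp <= M `^ pp * t `^ pm.
  rewrite -[leLHS](_ : t `^ (pp - pm) * t `^ pm = _); last first.
    by rewrite -powRD ?subrK// (gt_eqF t0) implybT.
  rewrite ler_wpM2r ?powR_ge0//; apply: (@le_trans _ _ (M `^ (pp - pm))).
    by apply: powR_le; lra.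
  by apply: ler_powR => //; lra.
by rewrite /theta -mulrA mulr_natl mulr2n lerD.
Qed.

Lemma measurable_theta : measurable_fun setT theta.
Proof. by apply: measurable_funD; exact: measurable_powR. Qed.

Lemma theta_comp_measurable (dT : measure_display) (T : measurableType dT) (f : T -> R) :
  measurable_fun setT f -> measurable_fun setT (fun x => theta `|f x|).
Proof.
move=> mf; apply: (measurableT_comp measurable_theta).
by apply: measurableT_comp mf; exact: normr_measurable.
Qed.
End Modular.

(** The sum counts the positive integers up to [t], capped at [K]; it is the minimum of [K] and the
    integer part of [t]. *)
Lemma layer_sum (R : realType) (K : nat) (t : R) : 0 <= t ->
  let S := \sum_(k < K) (if k.+1%:R <= t then 1 else 0 : R) in
  [/\ 0 <= S, S <= t & t <= K%:R -> t - 1 <= S].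
Proof.
move=> t0 /=.
suff [h1 h2] : (K%:R <= t -> \sum_(k < K) (if k.+1%:R <= t then 1 else 0 : R) = K%:R) /\
  (t <= K%:R -> t - 1 <= \sum_(k < K) (if k.+1%:R <= t then 1 else 0 : R) <= t).
  split; first by apply: sumr_ge0 => k _; case: ifP.
    by case: (leP t K%:R) => [/h2/andP[]//|/ltW tK]; rewrite h1.
  by move=> /h2/andP[].
elim: K => [|K [IH1 IH2]].
  by rewrite big_ord0; split => // t0'; apply/andP; split; lra.
rewrite big_ord_recr /=; case: (leP K.+1%:R t) => Kt.
  have Kt' : K%:R <= t by apply: le_trans Kt; rewrite ler_nat.
  rewrite (IH1 Kt') natr1; split => // tK.
  by have -> : t = K.+1%:R by [apply/le_anti/andP]; apply/andP; split; lra.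
rewrite addr0; split => [tK|_]; first by lra.
case: (leP t K%:R) => [/IH2//|/ltW Kt']; rewrite (IH1 Kt') Kt'.
by rewrite andbT lerBlDr natr1 ltW.
Qed.

(** * Approximation of bounded functions in the modular *)

Section ApproxFun.
Context (R : realType) (pm pp : R) (hpm : 1 < pm) (hpmpp : pm <= pp).
Context (d : nat) (Om : set 'rV[R]_d) (oOm : open Om).
Context (mu : {sigma_finite_measure set (Rd R d) -> \bar R}).
Hypothesis hmu : is_lebesgue mu.
Implicit Types f g h : Rd R d -> R.
Local Notation theta := (theta pm pp).

Definition approx_fun f : Prop := measurable_fun setT f /\
  forall e : R, 0 < e -> exists v : 'rV[R]_d -> R, dense_real Om v /\
    (\int[mu]_x (theta `|f x - v x|)%:E < e%:E)%E.

(** [theta] is subadditive only up to the factor [2^pp]; the thresholds [e / (2 * 2^pp)] absorb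
    it. *)
Lemma modular_sum f1 f2 f : measurable_fun setT f1 -> measurable_fun setT f2 ->
  (forall x, `|f x| <= `|f1 x| + `|f2 x|) -> forall e : R, 0 < e ->
  (\int[mu]_x (theta `|f1 x|)%:E < (e / (2 * 2 `^ pp))%:E)%E ->
  (\int[mu]_x (theta `|f2 x|)%:E < (e / (2 * 2 `^ pp))%:E)%E ->
  (\int[mu]_x (theta `|f x|)%:E < e%:E)%E.
Proof.
move=> m1 m2 fle e e0 h1 h2; set K := 2 `^ pp.
have K0 : 0 < K by exact: powR_gt0.
apply: (@le_lt_trans _ _ (\int[mu]_x (K%:E * ((theta `|f1 x|)%:E + (theta `|f2 x|)%:E)))%E).
  apply: le_integral_ae.
  - by move=> x _; rewrite lee_fin theta_ge0.
  - by move=> x _; rewrite -EFinD -EFinM lee_fin mulr_ge0 ?addr_ge0 ?theta_ge0// ltW.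
  - apply: aeW => x _; rewrite -EFinD -EFinM lee_fin.
    apply: le_trans (theta_add hpm hpmpp _ _) => //.
    exact: theta_le.
have mt1 := theta_comp_measurable pm pp m1; have mt2 := theta_comp_measurable pm pp m2.
rewrite ge0_integralZl//; last 3 first.
- by apply: emeasurable_funD; exact/measurable_EFinP.
- by move=> x _; rewrite -EFinD lee_fin addr_ge0 ?theta_ge0.
- by rewrite lee_fin ltW.
rewrite ge0_integralD//; last 4 first.
- by move=> x _; rewrite lee_fin theta_ge0.
- exact/measurable_EFinP.
- by move=> x _; rewrite lee_fin theta_ge0.
- exact/measurable_EFinP.
rewrite (_ : e%:E = K%:E * ((e / (2 * K))%:E + (e / (2 * K))%:E))%E.
  by rewrite lte_pmul2l// lteD.
by rewrite -EFinD -EFinM; congr EFin; field; rewrite gt_eqF.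
Qed.

Lemma modular_half_gt0 (e : R) : 0 < e -> 0 < e / (2 * 2 `^ pp).
Proof. by move=> e0; rewrite divr_gt0// mulr_gt0// powR_gt0. Qed.

Lemma approx_fun_add f g : approx_fun f -> approx_fun g ->
  approx_fun (fun x => f x + g x).
Proof.
move=> [mf hf] [mg hg]; split; first exact: measurable_funD.
move=> e e0; have e'0 := modular_half_gt0 e0.
have [v [dv hv]] := hf _ e'0; have [w [dw hw]] := hg _ e'0.
exists (fun x => v x + w x); split; first exact: dense_realD.
have mv := dense_real_measurable dv; have mw := dense_real_measurable dw.
apply: (modular_sum _ _ _ e0 hv hw).
- exact: measurable_funB.
- exact: measurable_funB.
- by move=> x; rewrite opprD addrACA; exact: ler_normD.
Qed.

Lemma approx_fun_limit f : measurable_fun setT f ->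
  (forall e : R, 0 < e -> exists g, approx_fun g /\
    (\int[mu]_x (theta `|f x - g x|)%:E < e%:E)%E) -> approx_fun f.
Proof.
move=> mf hf; split=> // e e0; have e'0 := modular_half_gt0 e0.
have [g [[mg hg] fg]] := hf _ e'0; have [v [dv hv]] := hg _ e'0.
exists v; split => //; have mv := dense_real_measurable dv.
apply: (modular_sum _ _ _ e0 fg hv).
- exact: measurable_funB.
- exact: measurable_funB.
- by move=> x; rewrite -[f x - v x](subrKA (g x)); exact: ler_normD.
Qed.

Lemma approx_funZ (q : rat) f : approx_fun f -> approx_fun (fun x => ratr q * f x).
Proof.
move=> [mf hf]; split; first exact: measurable_funM.
move=> e e0; set M : R := Num.max 1 `|ratr q| `^ pp.
have M0 : 0 < M by apply: powR_gt0; rewrite lt_max ltr01.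
have e'0 : 0 < e / M by rewrite divr_gt0.
have [v [dv hv]] := hf _ e'0.
have mv := dense_real_measurable dv.
exists (fun x => ratr q * v x); split; first exact: dense_realZ.
apply: (@le_lt_trans _ _ (\int[mu]_x (M%:E * (theta `|f x - v x|)%:E))%E).
  apply: le_integral_ae.
  - by move=> x _; rewrite lee_fin theta_ge0.
  - by move=> x _; rewrite -EFinM lee_fin mulr_ge0 ?theta_ge0// ltW.
  - apply: aeW => x _; rewrite -EFinM lee_fin -mulrBr normrM.
    exact: theta_scale.
rewrite ge0_integralZl//; last 3 first.
- by apply/measurable_EFinP; apply: theta_comp_measurable; exact: measurable_funB.
- by move=> x _; rewrite lee_fin theta_ge0.
- by rewrite lee_fin ltW.
rewrite (_ : e%:E = M%:E * (e / M)%:E)%E; first by rewrite lte_pmul2l.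
by rewrite -EFinM mulrC divfK// gt_eqF.
Qed.

(** The difference of two functions with values in [0,1] is at most 1 in absolute value, so
    [theta_le_lin] turns closeness in [L_1] into closeness in the modular. *)
Lemma approx_fun_indic (A : set (Rd R d)) : approx_set Om mu A -> approx_fun \1_A.
Proof.
move=> [mA hA]; split; first exact: measurable_indic.
move=> e e0; have e20 : 0 < e / 2 by lra.
have [v [dv [v01 hv]]] := hA _ e20.
have mv := dense_real_measurable dv.
exists v; split => //.
apply: (@le_lt_trans _ _ (\int[mu]_x (2%:E * (`|\1_A x - v x|)%:E))%E).
  apply: le_integral_ae.
  - by move=> x _; rewrite lee_fin theta_ge0.
  - by move=> x _; rewrite -EFinM lee_fin mulr_ge0.
  - apply: aeW => x _; rewrite -EFinM lee_fin; apply: theta_le_lin => //.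
    rewrite normr_ge0 /= indicE; have /andP[v0 v1] := v01 x.
    by rewrite ler_norml; case: (x \in A) => /=; apply/andP; split; lra.
rewrite ge0_integralZl//; last first.
  by apply/measurable_EFinP; exact: measurable_indic_sub.
rewrite (_ : e%:E = 2%:E * (e / 2)%:E)%E; first by rewrite lte_pmul2l.
by rewrite -EFinM; congr EFin; lra.
Qed.

Lemma approx_fun0 : approx_fun (fun=> 0).
Proof.
split; first exact: measurable_cst.
move=> e e0; exists (fun=> 0); split; first exact: dense_real0.
by rewrite integral0_eq ?lte_fin// => x _; rewrite subr0 normr0 theta0.
Qed.

Lemma approx_fun_sum (K : nat) (F : nat -> Rd R d -> R) :
  (forall k, approx_fun (F k)) -> approx_fun (fun x => \sum_(k < K) F k x).
Proof.
move=> hF; elim: K => [|K IH].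
  by under eq_fun do rewrite big_ord0; exact: approx_fun0.
by under eq_fun do rewrite big_ord_recr /=; exact: approx_fun_add.
Qed.

(** [f] is rounded down to a multiple of [1/(n+1)] by summing indicators of level sets. The error is
    at most the minimum of [f] and [1/(n+1)]; the bound by [f] supplies the integrable majorant
    [theta f], as [Om] may have infinite measure. *)
Lemma approx_fun_nneg (M : nat) f : measurable_fun setT f ->
  (forall x, 0 <= f x <= M%:R) -> (forall x, ~ Om x -> f x = 0) ->
  (\int[mu]_x (theta (f x))%:E < +oo)%E -> approx_fun f.
Proof.
move=> mf f0M fOm fin; apply: approx_fun_limit => // e e0.
have f0 x : 0 <= f x by have /andP[] := f0M x.
pose m n x := Num.min (f x) n.+1%:R^-1.
have inv0 n : 0 < n.+1%:R^-1 :> R by rewrite invr_gt0 ltr0n.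
have m0 n x : 0 <= m n x by rewrite le_min f0 ltW.
have mm n : measurable_fun setT (m n) by exact: measurable_minr.
have mt (g : Rd R d -> R) : measurable_fun setT g -> measurable_fun setT (fun x => theta (g x)).
  by move=> mg; exact: (measurableT_comp (measurable_theta pm pp)).
have [n hn] : exists n, (\int[mu]_x (theta (m n x))%:E < e%:E)%E.
  apply: (@dominated_small _ _ _ mu (fun n x => theta (m n x)) (fun x => theta (f x))) => //.
  - by move=> n; exact: mt.
  - exact: mt.
  - by move=> n x; rewrite theta_ge0 theta_le// ge_min lexx.
  - move=> x; apply: (@squeeze_cvgr _ _ _ _ (fun=> 0) (fun n => 2 * n.+1%:R^-1)).
    + near=> n; rewrite theta_ge0//=.
      have m1 : m n x <= n.+1%:R^-1 by rewrite ge_min lexx orbT.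
      apply: (@le_trans _ _ (2 * m n x)); last by rewrite ler_pM2l.
      apply: theta_le_lin => //; rewrite m0 (le_trans m1)//.
      by rewrite invf_le1 ?ltr0n// ler1n.
    + exact: cvg_cst.
    + rewrite -[X in _ --> X](mulr0 2); apply: cvgM; first exact: cvg_cst.
      exact: (@cvg_harmonic R).
pose A k : set (Rd R d) := [set x | k.+1%:R / n.+1%:R <= f x].
(* [M * (n+1)] layers of thickness [1/(n+1)] reach the maximal height [M]. The thickness is written
   with [ratr] so that [approx_funZ] applies. *)
pose g x := ratr (n.+1%:R^-1) * \sum_(k < M * n.+1) (\1_(A k) x : R).
have mA k : measurable (A k).
  rewrite (_ : A k = setT `&` f @^-1` `[k.+1%:R / n.+1%:R, +oo[).
    by apply: mf => //; exact: measurable_itv.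
  by apply/seteqP; split=> x; rewrite /A /= in_itv /= andbT; [split|case].
exists g; split.
  apply: approx_funZ; apply: (approx_fun_sum _ (F := fun k => \1_(A k))) => k; apply: approx_fun_indic.
  have kn0 : 0 < k.+1%:R / n.+1%:R :> R by rewrite divr_gt0.
  apply: approx_set_measurable => //.
    move=> x; rewrite /A /= => kx; apply: contrapT => /fOm fx0.
    by rewrite fx0 leNgt kn0 in kx.
  (* Chebyshev: [theta f] is at least this positive constant on [A k], so [A k] has finite
     measure. *)
  have th0 : 0 < theta (k.+1%:R / n.+1%:R) by rewrite addr_gt0 ?powR_gt0.
  rewrite -[A k]setIT -integral_indic//.
  rewrite -(@lte_pmul2l _ (theta (k.+1%:R / n.+1%:R))%:E) ?lte_fin//.
  rewrite -ge0_integralZl ?lee_fin ?theta_ge0//; last first.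
    by apply/measurable_EFinP; exact: measurable_indic.
  rewrite gt0_muley ?lte_fin//; apply: le_lt_trans fin.
  apply: le_integral_ae.
  - by move=> x _; rewrite -EFinM lee_fin mulr_ge0 ?theta_ge0.
  - by move=> x _; rewrite lee_fin theta_ge0.
  - apply: aeW => x _; rewrite -EFinM lee_fin indicE.
    case: (boolP (x \in A k)) => [|_]; last by rewrite mulr0 theta_ge0.
    by rewrite inE mulr1 => kx; apply: theta_le => //; exact: ltW.
apply: le_lt_trans hn; apply: le_integral_ae.
- by move=> x _; rewrite lee_fin theta_ge0.
- by move=> x _; rewrite lee_fin theta_ge0.
apply: aeW => x _; rewrite lee_fin; apply: theta_le => //.
have n0 : (0 : R) < n.+1%:R by rewrite ltr0n.
have fn0 : 0 <= n.+1%:R * f x by rewrite mulr_ge0.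
have [S0 S1 S2] := layer_sum (M * n.+1) fn0.
have -> : g x = n.+1%:R^-1 * \sum_(k < M * n.+1) (if k.+1%:R <= n.+1%:R * f x then 1 else 0 : R).
  rewrite /g fmorphV rmorph_nat; congr (_ * _); apply: eq_bigr => k _.
  rewrite indicE (_ : (x \in A k) = (k.+1%:R <= n.+1%:R * f x)); first by case: ifP.
  apply/idP/idP; rewrite inE /A /= ler_pdivrMr// mulrC//.
set S := \sum_(_ < _) _ in S0 S1 S2 *.
have {}S2 : n.+1%:R * f x - 1 <= S.
  apply: S2; rewrite natrM mulrC ler_wpM2r//.
  by have /andP[] := f0M x.
have gf : n.+1%:R^-1 * S <= f x by rewrite ler_pdivrMl.
rewrite ger0_norm ?subr_ge0// le_min; apply/andP; split.
  by rewrite gerBl mulr_ge0// ltW.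
by rewrite -(ler_pM2l n0) mulrBr !mulVKf ?gt_eqF// mulfV ?gt_eqF//; lra.
Unshelve. all: by end_near. Qed.

Lemma approx_fun_bounded (M : nat) f : measurable_fun setT f ->
  (forall x, `|f x| <= M%:R) -> (forall x, ~ Om x -> f x = 0) ->
  (\int[mu]_x (theta `|f x|)%:E < +oo)%E -> approx_fun f.
Proof.
move=> mf fM fOm fin.
have fle x (r : R) : 0 <= r <= `|f x| -> (theta r <= theta `|f x|).
  by move=> /andP[r0 rf]; exact: theta_le.
have sub h : measurable_fun setT h -> (forall x, 0 <= h x <= `|f x|) -> approx_fun h.
  move=> mh hf; apply: (@approx_fun_nneg M) => //.
  - by move=> x; have /andP[-> h2] := hf x; exact: le_trans h2 (fM x).
  - move=> x nx; have := hf x; rewrite fOm// normr0 => hx; exact/esym/le_anti.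
  - apply: le_lt_trans fin; apply: le_integral_ae.
    + by move=> x _; rewrite lee_fin theta_ge0.
    + by move=> x _; rewrite lee_fin theta_ge0.
    + by apply: aeW => x _; rewrite lee_fin; exact: fle.
have hp : approx_fun (fun x => Num.max (f x) 0).
  apply: sub; first exact: measurable_maxr.
  by move=> x; rewrite le_max lexx orbT /= ge_max ler_norm normr_ge0.
have hn : approx_fun (fun x => Num.max (- f x) 0).
  apply: sub; first by apply: measurable_maxr => //; exact: measurable_funN.
  by move=> x; rewrite le_max lexx orbT /= ge_max -normrN ler_norm normr_ge0.
have := approx_fun_add hp (approx_funZ (-1) hn); congr approx_fun.
apply/funext => x; rewrite rmorphN rmorph1 mulN1r.
by case: (leP (f x) 0); case: (leP (- f x) 0); lra.
Qed.
End ApproxFun.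

(** * Growth of the increment function *)

Section Cmod.
Context (R : realType).
Implicit Types (z w : R[i]) (l : R).

Lemma cmodE z : cmod z = Num.sqrt (complex.Re z ^+ 2 + complex.Im z ^+ 2).
Proof. by case: z. Qed.

Lemma cmod_ge0 z : 0 <= cmod z.
Proof. by rewrite cmodE sqrtr_ge0. Qed.

Lemma cmod0 : cmod (0 : R[i]) = 0.
Proof. exact: Normc.normc0. Qed.

Lemma cmodD z w : cmod (z + w) <= cmod z + cmod w.
Proof. exact: (@ler_normD _ (Rcomplex R) z w). Qed.

Lemma cmodN z : cmod (- z) = cmod z.
Proof. by rewrite !cmodE; case: z => a b /=; rewrite !sqrrN. Qed.

Lemma cmodB z w : cmod (z - w) <= cmod z + cmod w.
Proof. by rewrite -(cmodN w); exact: cmodD. Qed.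

Lemma cmod_div z l : 0 < l -> cmod (z / real_complex R l) = cmod z / l.
Proof.
move=> l0; rewrite /cmod Normc.normcM Normc.normcV; congr (_ / _).
by rewrite /= expr0n /= addr0 sqrtr_sqr gtr0_norm.
Qed.

Lemma cmod_le z w : `|complex.Re z| <= `|complex.Re w| ->
  `|complex.Im z| <= `|complex.Im w| -> cmod z <= cmod w.
Proof.
move=> re im; rewrite !cmodE ler_wsqrtr//.
by rewrite -(real_normK (num_real (complex.Re z))) -(real_normK (num_real (complex.Im z)))
  -(real_normK (num_real (complex.Re w))) -(real_normK (num_real (complex.Im w)))
  lerD// lerXn2r ?nnegrE.
Qed.

Lemma cmod_le_add z : cmod z <= `|complex.Re z| + `|complex.Im z|.
Proof.
rewrite cmodE -[leRHS]ger0_norm ?addr_ge0// -sqrtr_sqr ler_wsqrtr// sqrrD.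
by rewrite !real_normK ?num_real// lerD2r lerDl mulrn_wge0// mulr_ge0.
Qed.

Lemma Re_le_cmod z : `|complex.Re z| <= cmod z.
Proof. by rewrite cmodE -sqrtr_sqr ler_wsqrtr// lerDl sqr_ge0. Qed.

Lemma Im_le_cmod z : `|complex.Im z| <= cmod z.
Proof. by rewrite cmodE -sqrtr_sqr ler_wsqrtr// lerDr sqr_ge0. Qed.

Lemma measurable_cmod (dT : measure_display) (T : measurableType dT) (f g : T -> R) :
  measurable_fun setT f -> measurable_fun setT g ->
  measurable_fun setT (fun x => cmod (Complex (f x) (g x))).
Proof.
move=> mf mg; rewrite (_ : (fun _ => _) = fun x => (f x ^+ 2 + g x ^+ 2) `^ 2^-1).
  apply: (measurableT_comp (measurable_powR 2^-1)).
  by apply: measurable_funD; apply: measurable_funX.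
by apply/funext => x; rewrite powR12_sqrt ?addr_ge0 ?sqr_ge0.
Qed.
End Cmod.

(** * Truncation of real numbers *)

Section Clamp.
Context (R : realType).
Implicit Types (s t N : R).

Definition clamp N t : R := Num.max (- N) (Num.min t N).

Lemma clamp_norm N t : 0 <= N -> `|clamp N t| <= N /\ `|clamp N t| <= `|t|.
Proof.
move=> N0; rewrite !ler_norml /clamp.
have := ler_norm t; have := ler_norm (- t); rewrite normrN.
move=> t1 t2; case: (leP t N) => h1; last first.
  by case: (leP (- N) N) => h2; split; apply/andP; split; lra.
by case: (leP (- N) t) => h2; split; apply/andP; split; lra.
Qed.

Lemma clamp_id N t : `|t| <= N -> clamp N t = t.
Proof.
rewrite ler_norml /clamp => /andP[a b].
by rewrite (min_idPl b) (max_idPr a).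
Qed.

(** [t - clamp N t] is nondecreasing with slopes 0 or 1, hence 1-Lipschitz. It bounds the increments
    of what truncation removes. *)
Lemma clamp_contract N s t : `|(s - clamp N s) - (t - clamp N t)| <= `|s - t|.
Proof.
rewrite /clamp ler_norml.
have := ler_norm (s - t); have := ler_norm (- (s - t)); rewrite normrN.
by case: (leP s N); case: (leP t N); case: (leP (- N) s); case: (leP (- N) t);
  case: (leP (- N) N) => ? ? ? ? ? ? ?; apply/andP; split; lra.
Qed.

Lemma measurable_clamp (dT : measure_display) (T : measurableType dT) (f : T -> R) N :
  measurable_fun setT f -> measurable_fun setT (fun x => clamp N (f x)).
Proof.
move=> mf; apply: measurable_maxr; first exact: measurable_cst.
by apply: measurable_minr => //; exact: measurable_cst.
Qed.
End Clamp.

Section Growth.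
Context (R : realType) (pm pp beta c1 : R).
Context (hpm : 1 < pm) (hpmpp : pm <= pp) (hbeta : 1 <= beta) (hc1 : 0 < c1).
Local Notation theta := (theta pm pp).

(** Conditions (C3) and (C4) at a single pair of points, so that the estimates below concern one
    function of [t]. *)
Definition growth (ph : R -> R) : Prop :=
  (forall s t : R, 0 < s -> s <= t ->
    ph s / s `^ pm <= beta * (ph t / t `^ pm) /\
    ph t / t `^ pp <= beta * (ph s / s `^ pp)) /\
  (c1^-1 <= ph 1 <= c1 /\ ph 0 = 0 /\ forall t, 0 < t -> 0 < ph t).

Context (ph : R -> R) (hph : growth ph).

Lemma growth_ge0 t : 0 <= t -> 0 <= ph t.
Proof.
have [_ [_ [p0 pp0]]] := hph.
by rewrite le_eqVlt => /predU1P[<-|/pp0/ltW//]; rewrite p0.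
Qed.

Lemma growth_mono s t : 0 <= s -> s <= t -> ph s <= beta * ph t.
Proof.
have b1 := hbeta; have pm1 := hpm; have [hp [_ [p0 pp0]]] := hph.
rewrite le_eqVlt => /predU1P[<- t0|s0 st].
  by rewrite p0 mulr_ge0 ?growth_ge0//; lra.
have t0 := lt_le_trans s0 st.
have [+ _] := hp _ _ s0 st.
have spm := powR_gt0 pm s0; have tpm := powR_gt0 pm t0.
have st_pm : s `^ pm <= t `^ pm by apply: powR_le; lra.
rewrite ler_pdivrMr// => h; apply: le_trans h _.
rewrite -mulrA ler_wpM2l//; first lra.
by rewrite -mulrA ler_piMr ?(ltW (pp0 _ t0))// mulrC ler_pdivrMr// mul1r.
Qed.

(** Comparison with the value at 1: the exponent [pm] serves for [t <= 1], the exponent [pp] for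
    [t >= 1]. *)
Lemma growth_theta t : 0 <= t -> ph t <= beta * c1 * theta t.
Proof.
have b1 := hbeta; have pm1 := hpm; have c10 := hc1.
have [hp [/andP[_ p1] [p0 pp0]]] := hph.
have bc : 0 <= beta * c1 by rewrite mulr_ge0; lra.
rewrite le_eqVlt => /predU1P[<-|t0]; first by rewrite p0 mulr_ge0 ?theta_ge0.
have key q : ph t / t `^ q <= beta * (ph 1 / 1 `^ q) -> ph t <= beta * c1 * t `^ q.
  rewrite powR1 divr1 ler_pdivrMr ?powR_gt0// => /le_trans; apply.
  by rewrite ler_wpM2r ?powR_ge0// ler_wpM2l//; lra.
have [t1|/ltW t1] := leP t 1.
  have [+ _] := hp _ _ t0 t1 => /key /le_trans; apply.
  by rewrite ler_wpM2l// lerDl powR_ge0.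
have [_ +] := hp _ _ ltr01 t1 => /key /le_trans; apply.
by rewrite ler_wpM2l// lerDr powR_ge0.
Qed.

Lemma growth_scale k t : 1 <= k -> 0 <= t -> ph (k * t) <= beta * k `^ pp * ph t.
Proof.
have b1 := hbeta; have [hp [_ [p0 pp0]]] := hph.
move=> k1; rewrite le_eqVlt => /predU1P[<-|t0]; first by rewrite mulr0 p0 mulr0.
have k0 : 0 < k by lra.
have tkt : t <= k * t by rewrite ler_peMl// ltW.
have [_ +] := hp _ _ t0 tkt.
have k0' := ltW k0; have t0' := ltW t0.
rewrite ler_pdivrMr ?powR_gt0 ?mulr_gt0// powRM// => /le_trans; apply.
have tp : t `^ pp != 0 by rewrite gt_eqF ?powR_gt0.
by rewrite le_eqVlt; apply/orP; left; apply/eqP; field.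
Qed.

(** [s + t] is at most twice the larger of the two, so almost monotonicity applies. *)
Lemma growth_add s t : 0 <= s -> 0 <= t ->
  ph (s + t) <= beta * (ph (2 * s) + ph (2 * t)).
Proof.
have b1 := hbeta; move=> s0 t0.
have s2 := growth_ge0 (mulr_ge0 (ler0n R 2) s0).
have t2 := growth_ge0 (mulr_ge0 (ler0n R 2) t0).
have [st|/ltW ts] := leP s t.
  apply: (@le_trans _ _ (beta * ph (2 * t))); first by apply: growth_mono; lra.
  by rewrite ler_wpM2l//; lra.
apply: (@le_trans _ _ (beta * ph (2 * s))); first by apply: growth_mono; lra.
by rewrite ler_wpM2l//; lra.
Qed.

(* The part of the increment due to truncation is compared with [t0 / l0], where
   [ph] is integrable; the remaining part only with powers. *)
Lemma growth_split (e l0 s t0 t r : R) : 0 < e -> 0 < l0 ->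
  0 <= s <= t0 -> 0 <= t -> 0 <= r <= s + t ->
  ph (r / e) <=
    beta ^+ 4 * (Num.max 1 (2 * l0 / e) `^ pp) * ((s != 0)%:R * ph (t0 / l0)) +
    beta ^+ 3 * c1 * (Num.max 1 (2 / e) `^ pp) * theta t.
Proof.
have b1 := hbeta; have c10 := hc1; move=> e0 l00 /andP[s0 st0] t0' /andP[r0 rst].
have [_ [_ [p0 _]]] := hph.
have b0 : 0 <= beta by lra.
have ei : 0 < e^-1 by rewrite invr_gt0.
have li : 0 < l0^-1 by rewrite invr_gt0.
have t00 : 0 <= t0 by lra.
have q0 : 0 <= t0 / l0 by apply: mulr_ge0 => //; exact: ltW.
(* [k] is large enough for [2 * s / e <= k * (t0 / l0)], and at least 1 as [growth_scale]
   requires. *)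
set k := Num.max 1 _; have k1 : 1 <= k by rewrite le_max lexx.
have kk : 2 * l0 / e <= k by rewrite le_max lexx orbT.
set m := Num.max 1 _.
have h1 : ph (r / e) <= beta * ph (s / e + t / e).
  apply: growth_mono; first by rewrite divr_ge0// ltW.
  by rewrite -mulrDl ler_wpM2r// ltW.
have h2 := growth_add (divr_ge0 s0 (ltW e0)) (divr_ge0 t0' (ltW e0)).
(* The factor [s != 0] can be kept because [ph 0 = 0]; it later removes this term wherever
   truncation changes nothing. *)
have h3 : ph (2 * (s / e)) <= beta ^+ 2 * k `^ pp * ((s != 0)%:R * ph (t0 / l0)).
  have [->|sn0] := eqVneq s 0; first by rewrite mul0r mulr0 p0 mul0r mulr0.
  rewrite mul1r; apply: (@le_trans _ _ (beta * ph (k * (t0 / l0)))).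
    apply: growth_mono; first by rewrite mulr_ge0// divr_ge0// ltW.
    apply: (@le_trans _ _ ((2 * l0 / e) * (t0 / l0))); last exact: ler_wpM2r.
    rewrite (_ : 2 * l0 / e * (t0 / l0) = 2 * (t0 / e)); last by field; rewrite !gt_eqF.
    by rewrite ler_pM2l// ler_wpM2r// ltW.
  by rewrite expr2 -!mulrA ler_wpM2l// mulrA; exact: growth_scale.
have h4 : ph (2 * (t / e)) <= beta * c1 * m `^ pp * theta t.
  apply: le_trans (growth_theta _) _; first by rewrite mulr_ge0// divr_ge0// ltW.
  rewrite -[leRHS]mulrA; apply: ler_wpM2l; first by rewrite mulr_ge0// ltW.
  rewrite (_ : 2 * (t / e) = 2 / e * t); last by rewrite -mulrA (mulrC t).
  by apply: theta_scale => //; rewrite divr_ge0// ltW.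
(* Count of the factors [beta]: one each from [h1] and [h2], two from [h3], one from [h4]. *)
apply: (le_trans h1); apply: (@le_trans _ _ (beta * (beta * (ph (2 * (s / e)) + ph (2 * (t / e)))))).
  exact: ler_wpM2l.
rewrite (_ : _ + _ = beta * (beta * (beta ^+ 2 * k `^ pp * ((s != 0)%:R * ph (t0 / l0)) + beta * c1 * m `^ pp * theta t))); last by ring.
by do 2 apply: ler_wpM2l => //; exact: lerD.
Qed.
End Growth.

(** * The space L(Om) *)

Lemma lmeasurable_rep (dT : measure_display) (T : measurableType dT) (R : realType)
    (mu : {measure set T -> \bar R}) (D : set T) (f : T -> R) :
  measurable D -> lmeasurable mu D f -> exists g : T -> R,
    [/\ measurable_fun setT g, (forall x, ~ D x -> g x = 0) &
        {ae mu, forall x, D x -> f x = g x}].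
Proof.
move=> mD [g [mg fg]]; exists (g \_ D); split.
- exact/(measurable_restrictT _ _).1.
- by move=> x nx; rewrite patchE memNset.
- by apply: filterS fg => x fg Dx; rewrite patchE mem_set//; exact: fg.
Qed.

Lemma powR_add_le (R : realType) (p s t : R) : 0 <= p -> 0 <= s -> 0 <= t ->
  (s + t) `^ p <= 2 `^ p * (s `^ p + t `^ p).
Proof.
move=> p0 s0 t0; have [st|/ltW ts] := leP s t.
  apply: (@le_trans _ _ ((2 * t) `^ p)); first by apply: powR_le => //; lra.
  by rewrite powRM// ler_wpM2l ?powR_ge0// lerDr powR_ge0.
apply: (@le_trans _ _ ((2 * s) `^ p)); first by apply: powR_le => //; lra.
by rewrite powRM// ler_wpM2l ?powR_ge0// lerDl powR_ge0.
Qed.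

Lemma clamp_sub_norm (R : realType) (N t : R) : 0 <= N -> `|t - clamp N t| <= `|t|.
Proof.
move=> N0; have := clamp_contract N t 0.
by rewrite (clamp_id (N := N) (t := 0)) ?normr0// !subr0.
Qed.

Lemma complex_div_real (R : realType) (z : R[i]) (l : R) :
  z / real_complex R l = Complex (complex.Re z / l) (complex.Im z / l).
Proof.
rewrite -fmorphV; case: z => x y; apply/eqP.
by rewrite eq_complex /= !mulr0 subr0 add0r !eqxx.
Qed.

Section Space.
Context (R : realType) (d : nat).
Context (mu : {sigma_finite_measure set (Rd R d) -> \bar R}).
Hypothesis hmu : is_lebesgue mu.
Context (Om : set 'rV[R]_d) (oOm : open Om).
Context (a : 'rV[R]_d -> R) (ha0 : forall z, 0 <= a z).
Context (phi : R -> 'rV[R]_d -> 'rV[R]_d -> R).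
Context (hphi0 : forall t x y, 0 <= t -> Om x -> Om y -> 0 <= phi t x y).
Context (pm pp beta c1 : R).
Context (hpm : 1 < pm) (hpmpp : pm <= pp) (hbeta : 1 <= beta) (hc1 : 0 < c1).
Local Notation theta := (theta pm pp).
Local Notation Om2 := ((Om : set (Rd R d)) `*` (Om : set (Rd R d))).
Hypothesis hgrowth : {ae (mu \x mu)%E, forall z : Rd R d * Rd R d, Om2 z ->
  growth pm pp beta c1 (fun t => phi t z.1 z.2)}.
Context (al : Rd R d -> R) (mal : measurable_fun setT al) (al0 : forall x, 0 <= al x).
Hypothesis aal : {ae mu, forall x : Rd R d, a x = al x}.
Hypothesis ial : (\int[mu]_x (al x)%:E < +oo)%E.

Lemma measurable_Om : measurable (Om : set (Rd R d)).
Proof. exact: measurable_open. Qed.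

Lemma measurable_Om2 : measurable Om2.
Proof. by apply: measurableX; exact: measurable_Om. Qed.

Lemma kernel_ae : {ae (mu \x mu)%E, forall z : Rd R d * Rd R d,
  a ((z.1 : 'rV[R]_d) - (z.2 : 'rV[R]_d)) = al ((z.1 : 'rV[R]_d) - (z.2 : 'rV[R]_d))}.
Proof. exact: (negligible_sub hmu aal). Qed.

(** The integrand of [F] is replaced a.e. by a Borel majorant. Its [tw] terms are convolutions with
    [al], one in each variable, which explains the factor 2. *)
Lemma Ffun_bound (u : 'rV[R]_d -> R[i]) (G : Rd R d * Rd R d -> R) (tw : Rd R d -> R) (C : R) :
  measurable_fun setT G -> (forall z, 0 <= G z) ->
  measurable_fun setT tw -> (forall x, 0 <= tw x) -> 0 <= C ->
  {ae (mu \x mu)%E, forall z : Rd R d * Rd R d, Om2 z ->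
     phi (cmod (u z.1 - u z.2)) z.1 z.2 * a ((z.1 : 'rV[R]_d) - (z.2 : 'rV[R]_d)) <=
     G z + C * ((tw z.1 + tw z.2) * al ((z.1 : 'rV[R]_d) - (z.2 : 'rV[R]_d)))} ->
  (Ffun mu Om phi a u <= \int[mu \x mu]_z (G z)%:E +
     C%:E * (2%:E * (\int[mu]_x (tw x)%:E * \int[mu]_x (al x)%:E)))%E.
Proof.
move=> mG G0 mtw tw0 C0 hb.
pose k (z : Rd R d * Rd R d) := al ((z.1 : 'rV[R]_d) - (z.2 : 'rV[R]_d)).
have mk : measurable_fun setT k by exact: (measurableT_comp mal (@measurable_subr R d)).
have k0 z : 0 <= k z by exact: al0.
have m1 : measurable_fun setT (fun z : Rd R d * Rd R d => tw z.1 * k z).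
  by apply: measurable_funM => //; exact: (measurableT_comp mtw measurable_fst).
have m2 : measurable_fun setT (fun z : Rd R d * Rd R d => tw z.2 * k z).
  by apply: measurable_funM => //; exact: (measurableT_comp mtw measurable_snd).
pose H z := ((G z)%:E + C%:E * ((tw z.1 * k z)%:E + (tw z.2 * k z)%:E))%E.
have HE z : H z = (G z + C * ((tw z.1 + tw z.2) * k z))%:E.
  by rewrite mulrDl.
have H0 z : (0 <= H z)%E.
  by rewrite HE lee_fin addr_ge0// mulr_ge0// mulr_ge0// addr_ge0.
have mH : measurable_fun setT H.
  apply: emeasurable_funD; first exact/measurable_EFinP.
  apply: emeasurable_funM; first exact: measurable_cst.
  by apply: emeasurable_funD; exact/measurable_EFinP.
apply: (@le_trans _ _ (\int[mu \x mu]_(z in Om2) H z)%E).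
  apply: le_integral_ae => //.
    move=> z [Oz1 Oz2]; rewrite lee_fin mulr_ge0//; apply: hphi0 => //; exact: cmod_ge0.
  by apply: filterS hb => z hz /hz; rewrite HE lee_fin.
apply: (@le_trans _ _ (\int[mu \x mu]_z H z)%E).
  by apply: ge0_subset_integral => //; exact: measurable_Om2.
rewrite ge0_integralD//; last 4 first.
- by move=> z _; rewrite lee_fin.
- exact/measurable_EFinP.
- by move=> z _; apply: mule_ge0; rewrite ?lee_fin// addr_ge0//; exact: mulr_ge0.
- apply: emeasurable_funM; first exact: measurable_cst.
  by apply: emeasurable_funD; exact/measurable_EFinP.
rewrite ge0_integralZl//; last 2 first.
- by apply: emeasurable_funD; exact/measurable_EFinP.
- by move=> z _; rewrite -EFinD lee_fin addr_ge0//; exact: mulr_ge0.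
rewrite ge0_integralD//; last 4 first.
- by move=> z _; rewrite lee_fin mulr_ge0.
- exact/measurable_EFinP.
- by move=> z _; rewrite lee_fin mulr_ge0.
- exact/measurable_EFinP.
rewrite (integral_convl hmu mtw mal tw0 al0) (integral_convr hmu mtw mal tw0 al0).
by rewrite (mule_natl _ 2) mule2n.
Qed.

Lemma seminormF_le (u : 'rV[R]_d -> R[i]) (l : R) : 0 < l ->
  (Ffun mu Om phi a (fun x => (u x / real_complex R l)%R) <= 1)%E ->
  (seminormF mu Om phi a u <= l%:E)%E.
Proof. by move=> l0 Fl; apply: ereal_inf_lbound; exists l. Qed.

Lemma seminormF_ge0 (u : 'rV[R]_d -> R[i]) : (0 <= seminormF mu Om phi a u)%E.
Proof.
by apply: le_ereal_inf_tmp => _ [l [l0 _] <-]; rewrite lee_fin ltW.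
Qed.

Lemma fnorm_lt (u : 'rV[R]_d -> R[i]) (e : R) : 0 < e ->
  (Ffun mu Om phi a (fun x => (u x / real_complex R (e / 2))%R) <= 1)%E ->
  (\int[mu]_(x in (Om : set (Rd R d))) (cmod (u x) `^ pm)%:E < ((e / 2) `^ pm)%:E)%E ->
  (fnorm mu Om phi a pm u < e%:E)%E.
Proof.
have pm1 := hpm; move=> e0 hF hI; have e20 : 0 < e / 2 by lra.
have hs := seminormF_le e20 hF.
rewrite (_ : e%:E = (e / 2)%:E + (e / 2)%:E)%E; last by rewrite -EFinD -splitr.
rewrite /fnorm; apply: lee_ltD => //.
  rewrite ge0_fin_numE ?seminormF_ge0//; apply: le_lt_trans hs _; exact: ltry.
rewrite /Lpnorm.
set I := integral _ _ _ in hI *.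
have I0 : (0 <= I)%E by apply: integral_ge0 => x _; rewrite lee_fin powR_ge0.
have Ifin : I \is a fin_num.
  by rewrite ge0_fin_numE//; apply: lt_trans hI _; rewrite ltry.
have f0 : 0 <= fine I by exact: fine_ge0.
have hf : fine I < (e / 2) `^ pm by rewrite -lte_fin fineK.
change (I `^ pm^-1 < (e / 2)%:E)%E.
rewrite -(fineK Ifin); change ((fine I `^ pm^-1)%:E < (e / 2)%:E)%E; rewrite lte_fin.
have pm0 : 0 < pm by lra.
have hinv : 0 < pm^-1 by rewrite invr_gt0.
have -> : e / 2 = ((e / 2) `^ pm) `^ pm^-1.
  by rewrite -powRrM mulfV ?gt_eqF// powRr1// ltW.
by apply: (gt0_ltr_powR hinv); rewrite ?nnegrE ?powR_ge0.
Qed.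

(** Both exponents exceed 1, so dividing the argument by [l >= 1] gains at least a factor [1/l].
    This brings [F(g/l)] below 1 for large [l]. *)
Lemma theta_div (l t : R) : 1 <= l -> 0 <= t -> theta (t / l) <= l^-1 * theta t.
Proof.
have pm1 := hpm; have pmp := hpmpp; move=> l1 t0; have l0 : 0 < l by lra.
have key q : 1 < q -> (t / l) `^ q <= l^-1 * t `^ q.
  move=> q1; have li : 0 <= l^-1 by rewrite invr_ge0 ltW.
  rewrite powRM// mulrC ler_wpM2r ?powR_ge0//.
  by apply: ge1r_powR; rewrite ?invr_gt0 ?l0 ?invf_le1//=; lra.
by rewrite /theta mulrDr lerD// key; lra.
Qed.

Lemma continuous_compact_bound (g : 'rV[R]_d -> R) (K : set 'rV[R]_d) : compact K ->
  continuous g -> exists M, forall x, K x -> `|g x| <= M.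
Proof.
move=> cK cg; have : compact (g @` K).
  by apply: continuous_compact => //; exact: continuous_subspaceT.
move=> /compact_bounded[M [_ /(_ (M + 1))]]; rewrite ltrDl ltr01 => /(_ isT) h.
by exists (M + 1) => x Kx; apply: h; exists x.
Qed.

Lemma C0inf_Lcal g : C0inf Om g -> Lcal mu Om phi a pm g.
Proof.
have pm1 := hpm; have b1 := hbeta; have c10 := hc1.
move=> [sr [si [cK KOm]]]; set K := closure _ in cK KOm.
have mr : measurable_fun setT (fun x : Rd R d => complex.Re (g x)).
  by apply: continuous_measurable_Rd; exact: (sr 0%N).
have mi : measurable_fun setT (fun x : Rd R d => complex.Im (g x)).
  by apply: continuous_measurable_Rd; exact: (si 0%N).
have gK x : ~ K x -> g x = 0.
  by move=> nx; apply: contrapT => /eqP gx; apply: nx; exact: subset_closure.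
have [Mr hMr] := continuous_compact_bound cK (sr 0%N).
have [Mi hMi] := continuous_compact_bound cK (si 0%N).
have mc : measurable_fun setT (fun x : Rd R d => cmod (g x)).
  have := measurable_cmod mr mi; congr measurable_fun; apply/funext => x.
  by case: (g x).
pose tw (x : Rd R d) := theta (cmod (g x)).
have mtw : measurable_fun setT tw by exact: (measurableT_comp (measurable_theta pm pp)).
have tw0 x : 0 <= tw x by exact: theta_ge0.
have mK : measurable (K : set (Rd R d)) by apply: measurable_closed; exact: closed_closure.
have itw : (\int[mu]_x (tw x)%:E < +oo)%E.
  apply: (@le_lt_trans _ _ (\int[mu]_x ((theta (`|Mr| + `|Mi|))%:E * (\1_(K : set (Rd R d)) x)%:E))%E).
    apply: le_integral_ae.
    - by move=> x _; rewrite lee_fin.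
    - by move=> x _; rewrite -EFinM lee_fin mulr_ge0 ?theta_ge0.
    - apply: aeW => x _; rewrite -EFinM lee_fin indicE /tw.
      have [Kx|nx] := pselect (K x); last by rewrite gK// cmod0 theta0// mulr_ge0// theta_ge0.
      rewrite mem_set// mulr1; apply: theta_le => //; first exact: cmod_ge0.
      apply: le_trans (cmod_le_add _) _; apply: lerD.
        exact: le_trans (hMr _ Kx) (ler_norm _).
      exact: le_trans (hMi _ Kx) (ler_norm _).
  rewrite ge0_integralZl//; last 2 first.
  - by apply/measurable_EFinP; exact: measurable_indic.
  - by rewrite lee_fin theta_ge0.
  rewrite integral_indic// setIT.
  apply: lte_mul_pinfty => //; first by rewrite lee_fin theta_ge0.
  exact: (compact_measure_fin hmu cK).
have ipm (A : set (Rd R d)) : measurable A -> (\int[mu]_(x in A) (cmod (g x) `^ pm)%:E < +oo)%E.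
  move=> mA; apply: le_lt_trans itw.
  apply: (@le_trans _ _ (\int[mu]_(x in A) (tw x)%:E)%E).
    apply: le_integral_ae.
    - by move=> x _; rewrite lee_fin powR_ge0.
    - by move=> x _; rewrite lee_fin.
    - by apply: aeW => x _; rewrite lee_fin lerDl powR_ge0.
  apply: ge0_subset_integral => //; first exact/measurable_EFinP.
  by move=> x _; rewrite lee_fin.
split; first split.
- exists (fun x => complex.Re (g x)); split; last exact: aeW.
  exact: measurable_funTS.
- split.
    exists (fun x => complex.Im (g x)); split; last exact: aeW.
    exact: measurable_funTS.
  move=> L cL _; apply: ipm; apply: measurable_closed; exact: compact_closed cL.
apply: lte_add_pinfty; last by apply: poweR_lty; apply: ipm; exact: measurable_Om.
(* [growth_theta] contributes [beta * c1], and splitting the increment by [theta_add] contributes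
   [2^pp]. Then [F(g/l)] is at most [B / l] for [l >= 1]. *)
pose C0 := beta * c1 * 2 `^ pp.
have C00 : 0 <= C0 by rewrite !mulr_ge0 ?powR_ge0//; lra.
pose B := C0 * (2 * (fine (\int[mu]_x (tw x)%:E) * fine (\int[mu]_x (al x)%:E))).
pose l := Num.max 1 B.
have l1 : 1 <= l by rewrite le_max lexx.
have l0 : 0 < l by lra.
apply: le_lt_trans (seminormF_le l0 _) (ltry l).
apply: le_trans (@Ffun_bound _ (fun=> 0) tw (C0 / l) _ _ _ _ _ _) _ => //.
- by rewrite divr_ge0// ltW.
- apply: filterS2 hgrowth kernel_ae => z hz hk Oz; rewrite hk add0r mulrA.
  apply: ler_wpM2r => //; rewrite -mulrBl cmod_div//.
  apply: le_trans (growth_theta hpm hbeta hc1 (hz Oz) _) _.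
    by rewrite divr_ge0 ?cmod_ge0// ltW.
  rewrite /C0 -!mulrA ler_wpM2l//; first lra.
  rewrite ler_wpM2l//; first lra.
  apply: le_trans (theta_div l1 (cmod_ge0 _)) _.
  have li : 0 <= l^-1 by rewrite invr_ge0 ltW.
  rewrite mulrCA; apply: ler_wpM2l => //.
  apply: le_trans (theta_le hpm hpmpp (cmod_ge0 _) (cmodB _ _)) _.
  by apply: theta_add => //; exact: cmod_ge0.
- rewrite integral0_eq// add0e.
  rewrite -(fineK (_ : (\int[mu]_x (tw x)%:E)%E \is a fin_num)); last first.
    by rewrite ge0_fin_numE//; apply: integral_ge0 => x _; rewrite lee_fin.
  rewrite -(fineK (_ : (\int[mu]_x (al x)%:E)%E \is a fin_num)); last first.
    by rewrite ge0_fin_numE//; apply: integral_ge0 => x _; rewrite lee_fin.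
  rewrite -!EFinM lee_fin mulrAC -/B ler_pdivrMr// mul1r.
  by rewrite le_max lexx orbT.
Qed.

(** * Truncating an element of the space, and its approximation *)

Section Density.
Context (ur ui : Rd R d -> R).
Hypotheses (mur : measurable_fun setT ur) (mui : measurable_fun setT ui).

Definition cpl x : R[i] := Complex (ur x) (ui x).
(** Real and imaginary parts are clamped separately, so that [clamp_contract] applies to each and
    [cmod_le] recombines them. *)
Definition cut n x : R[i] := Complex (clamp n%:R (ur x)) (clamp n%:R (ui x)).
Definition rest n x : R := cmod (cpl x - cut n x).

Hypothesis icpl : (\int[mu]_x (cmod (cpl x) `^ pm)%:E < +oo)%E.

Lemma measurable_rest n : measurable_fun setT (rest n).
Proof.
by apply: (measurable_cmod (f := fun x => ur x - clamp n%:R (ur x))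
  (g := fun x => ui x - clamp n%:R (ui x))); apply: measurable_funB => //;
  exact: measurable_clamp.
Qed.

Lemma rest_le n x : rest n x <= cmod (cpl x).
Proof. by apply: cmod_le; exact: clamp_sub_norm. Qed.

Lemma rest_near0 x : \forall n \near \oo, rest n x = 0.
Proof.
near=> n; rewrite /rest /cut !clamp_id ?subrr ?cmod0//.
- by near: n; exact: nbhs_infty_ger.
- by near: n; exact: nbhs_infty_ger.
Unshelve. all: by end_near. Qed.

Lemma rest_small (e : R) : 0 < e ->
  \forall n \near \oo, (\int[mu]_x (rest n x `^ pm)%:E < e%:E)%E.
Proof.
have pm1 := hpm; have pm0 : 0 <= pm by lra.
apply: (dominated_near (f := fun n x => rest n x `^ pm) (g := fun x => cmod (cpl x) `^ pm)) => //.
- by move=> n; apply: (measurableT_comp (measurable_powR pm)); exact: measurable_rest.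
- by apply: (measurableT_comp (measurable_powR pm)); exact: measurable_cmod.
- move=> n x; rewrite powR_ge0 /=; apply: powR_le => //; [exact: cmod_ge0|exact: rest_le].
- move=> x; apply: cvg_near_cst.
  by apply: filterS (rest_near0 x) => n ->; rewrite powR0// gt_eqF//; lra.
Qed.

(** Off this set truncation changes neither point of the pair, so the increment of the removed part
    is zero. *)
Definition bad n : set (Rd R d * Rd R d) := [set z | rest n z.1 + rest n z.2 != 0].

Lemma measurable_bad n : measurable (bad n).
Proof.
have mh : measurable_fun setT (fun z : Rd R d * Rd R d => rest n z.1 + rest n z.2).
  apply: measurable_funD.
    exact: (measurableT_comp (measurable_rest n) measurable_fst).
  exact: (measurableT_comp (measurable_rest n) measurable_snd).
rewrite (_ : bad n = setT `&` (fun z => rest n z.1 + rest n z.2) @^-1` (~` [set 0])).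
  by apply: mh => //; exact: measurableC.
by rewrite setTI; apply/seteqP; split=> z /= /eqP.
Qed.

(** Every pair leaves [bad n] once [n] exceeds the finitely many values involved, and [G] is its own
    majorant. *)
Lemma bad_small (G : Rd R d * Rd R d -> R) (e : R) :
  measurable_fun setT G -> (forall z, 0 <= G z) ->
  (\int[mu \x mu]_z (G z)%:E < +oo)%E -> 0 < e ->
  \forall n \near \oo, (\int[mu \x mu]_z (\1_(bad n) z * G z)%:E < e%:E)%E.
Proof.
move=> mG G0 iG; apply: (dominated_near (f := fun n z => \1_(bad n) z * G z) (g := G)) => //.
- by move=> n; apply: measurable_funM => //; apply: measurable_indic; exact: measurable_bad.
- move=> n z; rewrite indicE; case: (z \in bad n); rewrite /= ?mul1r ?mul0r ?lexx ?G0//.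
- move=> z; apply: cvg_near_cst.
  apply: filterS2 (rest_near0 z.1) (rest_near0 z.2) => n h1 h2.
  by rewrite indicE memNset ?mul0r// /bad /= h1 h2 addr0 eqxx.
Qed.

Hypotheses (ur0 : forall x, ~ Om x -> ur x = 0) (ui0 : forall x, ~ Om x -> ui x = 0).

(** The clamped parts are bounded by [n] and by the modulus of [cpl], so [theta_bounded] and [icpl]
    give them finite modular. *)
Lemma cut_approx n (e : R) : 0 < e -> exists v w : 'rV[R]_d -> R,
  [/\ dense_real Om v, dense_real Om w &
      (\int[mu]_x (theta `|cmod (cut n x - Complex (v x) (w x))|)%:E < e%:E)%E].
Proof.
have pm1 := hpm; move=> e0; have e'0 := modular_half_gt0 pp e0.
have n0 : (0 : R) <= n%:R by rewrite ler0n.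
have key (f : Rd R d -> R) : measurable_fun setT f -> (forall x, ~ Om x -> f x = 0) ->
    (forall x, `|f x| <= cmod (cpl x)) -> approx_fun pm pp Om mu (fun x => clamp n%:R (f x)).
  move=> mf f0 fle; apply: (@approx_fun_bounded _ _ _ hpm hpmpp _ _ oOm _ hmu n).
  - exact: measurable_clamp.
  - by move=> x; have [] := clamp_norm (f x) n0.
  - by move=> x nx; rewrite f0// clamp_id// normr0.
  - have M1 : (1 : R) <= Num.max 1 n%:R by rewrite le_max lexx.
    apply: (@le_lt_trans _ _ (\int[mu]_x ((2 * Num.max 1 n%:R `^ pp)%:E * (cmod (cpl x) `^ pm)%:E))%E).
      apply: le_integral_ae.
      + by move=> x _; rewrite lee_fin theta_ge0.
      + by move=> x _; rewrite -EFinM lee_fin !mulr_ge0 ?powR_ge0.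
      + apply: aeW => x _; rewrite -EFinM lee_fin.
        have [cn cf] := clamp_norm (f x) n0.
        apply: le_trans (theta_bounded hpm hpmpp M1 _) _.
          by rewrite normr_ge0 le_max cn orbT.
        rewrite ler_wpM2l ?mulr_ge0 ?powR_ge0//; apply: powR_le => //; first lra.
        exact: le_trans cf (fle x).
    rewrite ge0_integralZl//; last 2 first.
    - by apply/measurable_EFinP; apply: (measurableT_comp (measurable_powR pm)); exact: measurable_cmod.
    - by move=> x _; rewrite lee_fin powR_ge0.
    by apply: lte_mul_pinfty => //; rewrite lee_fin mulr_ge0 ?powR_ge0.
have [mr' /(_ _ e'0)[v [dv hv]]] := key ur mur ur0 (fun x => Re_le_cmod (cpl x)).
have [mi' /(_ _ e'0)[w [dw hw]]] := key ui mui ui0 (fun x => Im_le_cmod (cpl x)).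
exists v, w; split => //.
apply: (modular_sum hpm hpmpp _ _ _ e0 hv hw).
- by apply: measurable_funB => //; exact: dense_real_measurable dv.
- by apply: measurable_funB => //; exact: dense_real_measurable dw.
- by move=> x; rewrite ger0_norm ?cmod_ge0//; exact: cmod_le_add.
Qed.
End Density.

(** Gives local integrability from local [L_pm] integrability, which (C1) asks for. *)
Lemma le_add1_powR t : 0 <= t -> t <= 1 + t `^ pm.
Proof.
have pm1 := hpm; move=> t0; have [t1|/ltW t1] := leP t 1.
  by apply: le_trans t1 _; rewrite lerDl powR_ge0.
by apply: (le_trans (le1r_powR t1 (ltW pm1))); rewrite lerDr.
Qed.

(** [u - g] is the part removed by truncation plus [W = cut - g]. [growth_split] charges the first
    to [G] on the bad set and the second to [theta |W|]; the height [n] is fixed before [g] is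
    chosen. *)
Lemma dense_fam_dense (u : 'rV[R]_d -> R[i]) :
  (forall v : 'rV[R]_d -> R[i], Lploc mu Om 1 v ->
     lmeasurable (mu \x mu)%E Om2
       (fun z : Rd R d * Rd R d => phi (cmod (v z.1 - v z.2)) z.1 z.2)) ->
  Lcal mu Om phi a pm u -> forall e : R, 0 < e -> exists g, dense_fam Om g /\
    (fnorm mu Om phi a pm (fun x => (u x - g x)%R) < e%:E)%E.
Proof.
have pm1 := hpm; have b1 := hbeta; have c10 := hc1; have pm0 : 0 <= pm by lra.
move=> hC1 [[lr [li _]] fin] e e0; have e20 : 0 < e / 2 by lra.
(* Finiteness of the infimum yields one scale at which [F] is finite; [l0] need not be small. *)
have [l0 [l00 Fl0]] : exists l0 : R, 0 < l0 /\
    (Ffun mu Om phi a (fun x => (u x / real_complex R l0)%R) <= 1)%E.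
  have : (seminormF mu Om phi a u < +oo)%E.
    by apply: le_lt_trans fin; rewrite leeDl// poweR_ge0.
  by move=> /ereal_inf_lt[_ [l [l0 Fl] _] _]; exists l.
have iu : (\int[mu]_(x in (Om : set (Rd R d))) (cmod (u x) `^ pm)%:E < +oo)%E.
  have : (Lpnorm mu Om pm u < +oo)%E.
    by apply: le_lt_trans fin; rewrite leeDr// seminormF_ge0.
  rewrite /Lpnorm ltey; apply: contra_neqT; rewrite -leNgt leye_eq => /eqP ->.
  by rewrite poweRyr// invr_eq0 gt_eqF//; lra.
have [ur [mur ur0 uur]] := lmeasurable_rep measurable_Om lr.
have [ui [mui ui0 uui]] := lmeasurable_rep measurable_Om li.
have uU : {ae mu, forall x : Rd R d, Om x -> u x = cpl ur ui x}.
  apply: filterS2 uur uui => x hr hi Ox; rewrite /cpl -hr// -hi//.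
  by case: (u x).
have icpl : (\int[mu]_x (cmod (cpl ur ui x) `^ pm)%:E < +oo)%E.
  apply: le_lt_trans iu; rewrite [leRHS]integral_mkcond.
  apply: le_integral_ae.
  - by move=> x _; rewrite lee_fin powR_ge0.
  - by move=> x _; rewrite erestrict_ge0// => y _; rewrite lee_fin powR_ge0.
  - apply: filterS uU => x hx _; rewrite patchE.
    case: (boolP (x \in (Om : set (Rd R d)))) => [/set_mem Ox|/negP nx]; first by rewrite hx.
    have nOx : ~ Om x by move=> Ox; apply: nx; exact: mem_set.
    by rewrite /cpl ur0// ui0// [cmod _](_ : _ = 0) ?powR0 ?gt_eqF//; [lra|exact: cmod0].
have Lv : Lploc mu Om 1 (fun x => u x / real_complex R l0).
  split; first (exists (fun x => ur x / l0); split).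
  - by apply: measurable_funTS; apply: measurable_funM => //; exact: measurable_cst.
  - by apply: filterS uur => x hx Ox; rewrite complex_div_real /= hx.
  split; first (exists (fun x => ui x / l0); split).
  - by apply: measurable_funTS; apply: measurable_funM => //; exact: measurable_cst.
  - by apply: filterS uui => x hx Ox; rewrite complex_div_real /= hx.
  move=> K cK KOm; have mK : measurable (K : set (Rd R d)).
    by apply: measurable_closed; exact: compact_closed cK.
  have mpow : measurable_fun setT (fun x => (cmod (cpl ur ui x) `^ pm)%:E).
    by apply/measurable_EFinP; apply: (measurableT_comp (measurable_powR pm)); exact: measurable_cmod.
  apply: (@le_lt_trans _ _ (\int[mu]_(x in (K : set (Rd R d)))
      (1%:E + (l0^-1 `^ pm)%:E * (cmod (cpl ur ui x) `^ pm)%:E))%E).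
    apply: le_integral_ae.
    - by move=> x _; rewrite lee_fin powR_ge0.
    - by move=> x _; rewrite -EFinM -EFinD lee_fin addr_ge0// mulr_ge0 ?powR_ge0.
    - apply: filterS uU => x hx /KOm /hx ->; rewrite -EFinM -EFinD lee_fin.
      rewrite cmod_div//; have c0 := cmod_ge0 (cpl ur ui x).
      rewrite powRr1 ?divr_ge0 ?(ltW l00)//.
      apply: le_trans (le_add1_powR _) _; first by rewrite divr_ge0// ltW.
      by rewrite mulrC powRM// invr_ge0 ltW.
  rewrite ge0_integralD//; last 2 first.
  - by move=> x _; rewrite -EFinM lee_fin mulr_ge0 ?powR_ge0.
  - by apply: emeasurable_funM; [exact: measurable_cst|exact: measurable_funTS].
  rewrite integral_cst// mul1e ge0_integralZl//; last 3 first.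
  - exact: measurable_funTS.
  - by move=> x _; rewrite lee_fin powR_ge0.
  - by rewrite lee_fin powR_ge0.
  apply: lte_add_pinfty; first exact: (compact_measure_fin hmu cK).
  apply: lte_mul_pinfty => //; first by rewrite lee_fin powR_ge0.
  apply: le_lt_trans icpl; apply: ge0_subset_integral => //.
  by move=> x _; rewrite lee_fin powR_ge0.
have [g0 [mg0 g00 g0E]] := lmeasurable_rep measurable_Om2 (hC1 _ Lv).
pose k (z : Rd R d * Rd R d) := al ((z.1 : 'rV[R]_d) - (z.2 : 'rV[R]_d)).
have mk : measurable_fun setT k by exact: (measurableT_comp mal (@measurable_subr R d)).
(* A Borel version of the integrand of [F(u/l0)], hence integrable; the maximum with 0 makes it
   nonnegative at every point. *)
pose G z := Num.max 0 (g0 z) * k z.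
have G0 z : 0 <= G z by rewrite mulr_ge0 ?al0// le_max lexx.
have mG : measurable_fun setT G.
  by apply: measurable_funM => //; apply: measurable_maxr => //; exact: measurable_cst.
have GE : {ae (mu \x mu)%E, forall z : Rd R d * Rd R d, Om2 z ->
    G z = phi (cmod (u z.1 / real_complex R l0 - u z.2 / real_complex R l0)) z.1 z.2 *
      a ((z.1 : 'rV[R]_d) - (z.2 : 'rV[R]_d))}.
  apply: filterS2 g0E kernel_ae => z hz hk Oz; rewrite /G -hz// /k hk.
  congr (_ * _); apply/max_idPr; case: Oz => zO1 zO2.
  by apply: hphi0 => //; exact: cmod_ge0.
have iG : (\int[mu \x mu]_z (G z)%:E < +oo)%E.
  apply: (@le_lt_trans _ _ 1%E); last exact: ltry.
  apply: le_trans Fl0; rewrite /Ffun [leRHS]integral_mkcond.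
  apply: le_integral_ae.
  - by move=> z _; rewrite lee_fin.
  - move=> z _; apply: erestrict_ge0 => y [zO1 zO2].
    by rewrite lee_fin mulr_ge0//; apply: hphi0 => //; exact: cmod_ge0.
  - apply: filterS GE => z hz _; rewrite patchE.
    case: (boolP (z \in Om2)) => [/set_mem Oz|/negP nz]; first by rewrite hz.
    have nOz : ~ Om2 z by move=> Oz; apply: nz; exact: mem_set.
    by rewrite /G g00// maxxx mul0r.
(* [A] and [B] are the constants of [growth_split] at scale [e / 2]; [B] has a further [2^pp] for
   separating the two points in [theta]. *)
pose A := beta ^+ 4 * Num.max 1 (2 * l0 / (e / 2)) `^ pp.
have A0 : 0 < A.
  by rewrite mulr_gt0 ?exprn_gt0 ?powR_gt0// ?lt_max ?ltr01//; lra.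
pose B := beta ^+ 3 * c1 * Num.max 1 (2 / (e / 2)) `^ pp * 2 `^ pp.
have B0 : 0 < B.
  by rewrite !mulr_gt0 ?exprn_gt0 ?powR_gt0// ?lt_max ?ltr01//; lra.
pose J := fine (\int[mu]_x (al x)%:E).
have JE : (\int[mu]_x (al x)%:E = J%:E)%E.
  by rewrite fineK// ge0_fin_numE//; apply: integral_ge0 => x _; rewrite lee_fin.
have J0 : 0 <= J.
  by rewrite -lee_fin -JE; apply: integral_ge0 => x _; rewrite lee_fin.
(* Chosen so that [2^pm * (rho + rho) = (e/2)^pm], where [2^pm] comes from [powR_add_le]. *)
pose rho := (e / 2) `^ pm / (2 * 2 `^ pm).
have rho0 : 0 < rho by rewrite divr_gt0 ?mulr_gt0 ?powR_gt0.
(* The second bound gives [B * 2 * tau * J <= 1/2]; [J + 1] avoids division by zero when the kernel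
   has mass 0. *)
pose tau := Num.min rho (1 / (4 * B * (J + 1))).
have tau0 : 0 < tau.
  by rewrite lt_min rho0 /= divr_gt0// mulr_gt0//; [rewrite mulr_gt0|lra].
have A20 : 0 < 1 / (2 * A) by rewrite divr_gt0// mulr_gt0.
(* One height must serve both parts of the norm, hence the statements for all large [n]. *)
have [n [hn1 hn2]] := filter_ex (filterI (rest_small mur mui icpl rho0)
  (bad_small mur mui mG G0 iG A20)).
have [v [w [dv dw hvw]]] := cut_approx mur mui icpl ur0 ui0 n tau0.
pose g x := Complex (v x) (w x).
exists g; split; first exact: dense_fam_complex.
pose W x := cut ur ui n x - g x.
pose tw (x : Rd R d) := theta `|cmod (W x)|.
have mv := dense_real_measurable dv; have mw := dense_real_measurable dw.
have mcW : measurable_fun setT (fun x : Rd R d => cmod (W x)).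
  apply: (measurable_cmod (f := fun x : Rd R d => clamp n%:R (ur x) - v x)
    (g := fun x : Rd R d => clamp n%:R (ui x) - w x)).
  - by apply: measurable_funB => //; exact: measurable_clamp.
  - by apply: measurable_funB => //; exact: measurable_clamp.
have mtw : measurable_fun setT tw by exact: theta_comp_measurable.
have tw0 x : 0 <= tw x by exact: theta_ge0.
have twE x : tw x = theta (cmod (W x)) by rewrite /tw ger0_norm// cmod_ge0.
have htw : (\int[mu]_x (tw x)%:E < tau%:E)%E := hvw.
have decomp x : u x = cpl ur ui x -> u x - g x = (cpl ur ui x - cut ur ui n x) + W x.
  by move=> ->; rewrite /W subrKA.
apply: fnorm_lt => //.
- apply: le_trans (@Ffun_bound _ (fun z => A * (\1_(bad ur ui n) z * G z)) tw B _ _ _ _ _ _) _ => //.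
  + apply: measurable_funM; first exact: measurable_cst.
    by apply: measurable_funM => //; apply: measurable_indic; exact: measurable_bad.
  + by move=> z; rewrite mulr_ge0 ?(ltW A0)// mulr_ge0// indicE.
  + exact: ltW.
  + have U1 := negligible_fst uU; have U2 := negligible_snd uU.
    have UU : {ae (mu \x mu)%E, forall z : Rd R d * Rd R d, Om2 z ->
        u z.1 = cpl ur ui z.1 /\ u z.2 = cpl ur ui z.2}.
      by apply: filterS2 U1 U2 => z h1 h2 [zO1 zO2]; split; [exact: h1|exact: h2].
    have gk : {ae (mu \x mu)%E, forall z : Rd R d * Rd R d, Om2 z ->
        growth pm pp beta c1 (fun t => phi t z.1 z.2) /\
        a ((z.1 : 'rV[R]_d) - (z.2 : 'rV[R]_d)) = k z}.
      by apply: filterS2 hgrowth kernel_ae => z hg hk Oz; split; [exact: hg|].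
    apply: filterS3 UU gk GE => z hU hgk hG Oz.
    have [u1 u2] := hU Oz; have [gr hk] := hgk Oz.
    rewrite -mulrBl cmod_div// hk.
    have kz0 : 0 <= k z by exact: al0.
    have := hG Oz; rewrite hk -mulrBl cmod_div// => GzE.
    set s := cmod ((cpl ur ui z.1 - cut ur ui n z.1) - (cpl ur ui z.2 - cut ur ui n z.2)).
    have s_le : s <= cmod (u z.1 - u z.2).
      by rewrite u1 u2; apply: cmod_le; exact: clamp_contract.
    have r_le : cmod ((u z.1 - g z.1) - (u z.2 - g z.2)) <= s + (cmod (W z.1) + cmod (W z.2)).
      rewrite (decomp _ u1) (decomp _ u2) opprD addrACA.
      by apply: le_trans (cmodD _ _) _; rewrite lerD2l; exact: cmodB.
    have s0 : 0 <= s <= cmod (u z.1 - u z.2) by rewrite cmod_ge0.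
    have t0 : 0 <= cmod (W z.1) + cmod (W z.2) by rewrite addr_ge0 ?cmod_ge0.
    have r0 : 0 <= cmod ((u z.1 - g z.1) - (u z.2 - g z.2)) <= s + (cmod (W z.1) + cmod (W z.2)).
      by rewrite cmod_ge0.
    have := growth_split hpm hpmpp hbeta hc1 gr e20 l00 s0 t0 r0.
    move=> /(fun h => ler_wpM2r kz0 h) /le_trans; apply.
    rewrite mulrDl; apply: lerD.
      rewrite -/A GzE -(mulrA A); apply: ler_wpM2l; first exact: ltW.
      rewrite -mulrA.
      apply: ler_wpM2r.
        rewrite mulr_ge0//; apply: (growth_ge0 gr).
        by rewrite divr_ge0 ?cmod_ge0// ltW.
      (* Outside the bad set both remainders vanish, so [s = 0] and the factor [s != 0] is 0. *)
      rewrite indicE; have [zb|nb] := pselect (bad ur ui n z).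
        by rewrite mem_set//; case: (s != 0); rewrite ?ler01.
      have : ~~ (rest ur ui n z.1 + rest ur ui n z.2 != 0) by apply/negP.
      rewrite negbK paddr_eq0 ?cmod_ge0// => /andP[/eqP r1 /eqP r2].
      rewrite (_ : s = 0) ?eqxx ?indicE//.
      by rewrite /s (Normc.eq0_normc r1) (Normc.eq0_normc r2) subrr cmod0.
    rewrite mulrA; apply: ler_wpM2r => //; rewrite /B -(mulrA _ (2 `^ pp)).
    apply: ler_wpM2l; last by rewrite !twE; apply: theta_add => //; exact: cmod_ge0.
    by rewrite !mulr_ge0 ?exprn_ge0 ?powR_ge0//; lra.
  + rewrite (_ : 1%E = (2^-1)%:E + (2^-1)%:E)%E; last by rewrite -EFinD; congr EFin; lra.
    apply: leeD.
      under eq_integral do rewrite EFinM.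
      rewrite ge0_integralZl//; last 3 first.
      * apply/measurable_EFinP; apply: measurable_funM => //.
        by apply: measurable_indic; exact: measurable_bad.
      * by move=> z _; rewrite lee_fin mulr_ge0// indicE.
      * by rewrite lee_fin ltW.
      rewrite (_ : (2^-1)%:E = A%:E * (1 / (2 * A))%:E)%E.
        by apply: lee_wpmul2l; [rewrite lee_fin ltW|exact: ltW].
      by rewrite -EFinM; congr EFin; field; rewrite gt_eqF.
    rewrite JE; apply: (@le_trans _ _ (B%:E * (2%:E * (tau%:E * J%:E)))%E).
      do 2 (apply: lee_wpmul2l; first by rewrite lee_fin// ltW).
      by apply: lee_wpmul2r; [rewrite lee_fin|exact: ltW].
    rewrite -!EFinM lee_fin.
    have tauJ : tau <= 1 / (4 * B * (J + 1)) by rewrite ge_min lexx orbT.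
    have BJ : 0 < 4 * B * (J + 1) by apply: mulr_gt0; [exact: mulr_gt0|lra].
    move: tauJ; rewrite ler_pdivlMr// => tauJ.
    have tB : 0 <= tau * B by rewrite mulr_ge0// ltW.
    by nra.
- apply: (@le_lt_trans _ _ (\int[mu]_x ((2 `^ pm)%:E * ((rest ur ui n x `^ pm)%:E + (tw x)%:E)))%E).
    rewrite integral_mkcond; apply: le_integral_ae.
    + by move=> x _; apply: erestrict_ge0 => y _; rewrite lee_fin powR_ge0.
    + move=> x _; rewrite -EFinD -EFinM lee_fin mulr_ge0 ?powR_ge0//.
      by rewrite addr_ge0// powR_ge0.
    + apply: filterS uU => x hx _; rewrite patchE -EFinD -EFinM.
      case: (boolP (x \in (Om : set (Rd R d)))) => [/set_mem Ox|_]; last first.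
        by rewrite lee_fin mulr_ge0 ?powR_ge0// addr_ge0// powR_ge0.
      rewrite lee_fin (decomp _ (hx Ox)).
      apply: (@le_trans _ _ ((rest ur ui n x + cmod (W x)) `^ pm)).
        by apply: powR_le => //; [exact: cmod_ge0|exact: cmodD].
      apply: le_trans (powR_add_le pm0 (cmod_ge0 _) (cmod_ge0 _)) _.
      (* Here the summand [t^pm] of [theta] bounds the [L_pm] part of [W]. *)
      by rewrite ler_wpM2l ?powR_ge0// lerD2l twE lerDl powR_ge0.
  have mre : measurable_fun setT (fun x => (rest ur ui n x `^ pm)%:E).
    by apply/measurable_EFinP; apply: (measurableT_comp (measurable_powR pm)); exact: measurable_rest.
  have mtw' : measurable_fun setT (fun x => (tw x)%:E) by exact/measurable_EFinP.
  rewrite ge0_integralZl//; last 2 first.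
  + exact: emeasurable_funD.
  + by move=> x _; rewrite -EFinD lee_fin addr_ge0// powR_ge0.
  rewrite ge0_integralD//; last 2 first.
  + by move=> x _; rewrite lee_fin powR_ge0.
  + by move=> x _; rewrite lee_fin.
  rewrite (_ : ((e / 2) `^ pm)%:E = (2 `^ pm)%:E * (rho%:E + rho%:E))%E.
    rewrite lte_pmul2l ?lte_fin ?powR_gt0//; apply: lteD => //.
    by apply: lt_le_trans htw _; rewrite lee_fin ge_min lexx.
  rewrite -EFinD -EFinM; congr EFin; rewrite /rho; field.
  by rewrite gt_eqF// powR_gt0.
Qed.
End Space.

Unset Implicit Arguments.
Set Strict Implicit.

Theorem theorem2p3
  (R : realType) (d : nat) (hd : (1 <= d)%N)
  (mu : {sigma_finite_measure set (Rd R d) -> \bar R})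
  (hmu : is_lebesgue mu)
  (Om : set 'rV[R]_d) (hOm : open Om)
  (* the kernel a *)
  (a : 'rV[R]_d -> R)
  (ha_meas : lmeasurable mu setT (a : Rd R d -> R))
  (ha_int : (\int[mu]_(z in (setT : set (Rd R d))) (`|a z|)%:E < +oo)%E)
  (ha0 : forall z, 0 <= a z)
  (r0 c0 : R) (hr0 : 0 < r0) (hc0 : 0 < c0)
  (haB : {ae mu, forall z : Rd R d, enorm (z : 'rV[R]_d) < r0 -> c0 <= a z})
  (* connected components of Om, consecutive ones closer than diam B_0 *)
  (hcomp : ~ connected Om ->
     exists (I : set nat) (Omc : nat -> set 'rV[R]_d),
       (forall i, I i.+1 -> I i) /\
       (forall i, I i -> exists x, Om x /\ Omc i = connected_component Om x) /\
       (forall x, Om x -> exists i, I i /\ Omc i = connected_component Om x) /\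
       (forall i j, I i -> I j -> Omc i = Omc j -> i = j) /\
       (forall i, I i.+1 -> sdist (Omc i) (Omc i.+1) < 2 * r0))
  (* phi *)
  (phi : R -> 'rV[R]_d -> 'rV[R]_d -> R)
  (hphi0 : forall t x y, 0 <= t -> Om x -> Om y -> 0 <= phi t x y)
  (* (C1) *)
  (hC1 : forall u : 'rV[R]_d -> R[i], Lploc mu Om 1 u ->
     lmeasurable (mu \x mu)%E ((Om : set (Rd R d)) `*` (Om : set (Rd R d)))
       (fun z : Rd R d * Rd R d => phi (cmod (u z.1 - u z.2)) z.1 z.2))
  (* (C2) *)
  (hC2 : forall eps : R, 0 < eps -> exists delta : R, 0 < delta < 1 /\
     {ae (mu \x mu)%E, forall z : Rd R d * Rd R d,
        ((Om : set (Rd R d)) `*` (Om : set (Rd R d))) z ->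
        forall s t : R, 0 < s -> 0 < t -> eps * Num.max s t <= `|s - t| ->
          phi ((s + t) / 2) z.1 z.2
            <= (1 - delta) * ((phi s z.1 z.2 + phi t z.1 z.2) / 2)})
  (* (C3) *)
  (pm pp beta : R) (hpm : 1 < pm) (hpmpp : pm <= pp) (hbeta : 1 <= beta)
  (hC3 : {ae (mu \x mu)%E, forall z : Rd R d * Rd R d,
        ((Om : set (Rd R d)) `*` (Om : set (Rd R d))) z ->
        forall s t : R, 0 < s -> s <= t ->
          phi s z.1 z.2 / s `^ pm <= beta * (phi t z.1 z.2 / t `^ pm) /\
          phi t z.1 z.2 / t `^ pp <= beta * (phi s z.1 z.2 / s `^ pp)})
  (* (C4) *)
  (c1 : R) (hc1 : 0 < c1)
  (hC4 : {ae (mu \x mu)%E, forall z : Rd R d * Rd R d,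
        ((Om : set (Rd R d)) `*` (Om : set (Rd R d))) z ->
        c1^-1 <= phi 1 z.1 z.2 <= c1 /\ phi 0 z.1 z.2 = 0 /\
        forall t : R, 0 < t -> 0 < phi t z.1 z.2}) :
  (* C_0^infty(Om) is a subset of L(Om) ... *)
  (forall g, C0inf Om g -> Lcal mu Om phi a pm g) /\
  (* ... dense for the norm f ... *)
  (forall u, Lcal mu Om phi a pm u -> forall eps : R, 0 < eps ->
     exists g, C0inf Om g /\
       (fnorm mu Om phi a pm (fun x => (u x - g x)%R) < eps%:E)%E) /\
  (* ... and L(Om) is separable *)
  (exists D : set ('rV[R]_d -> R[i]), countable D /\
     D `<=` Lcal mu Om phi a pm /\
     forall u, Lcal mu Om phi a pm u -> forall eps : R, 0 < eps ->
       exists v, D v /\ (fnorm mu Om phi a pm (fun x => (u x - v x)%R) < eps%:E)%E).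
Proof.
have hg : {ae (mu \x mu)%E, forall z : Rd R d * Rd R d,
    ((Om : set (Rd R d)) `*` (Om : set (Rd R d))) z ->
    growth pm pp beta c1 (fun t => phi t z.1 z.2)}.
  by apply: filterS2 hC3 hC4 => z h3 h4 Oz; split; [exact: h3|exact: h4].
have [b [mb _ ab]] := lmeasurable_rep measurableT ha_meas.
(* Clipping at 0 makes the Borel representative nonnegative everywhere and keeps it a.e. equal to
   [a], since [a >= 0]. *)
pose al (x : Rd R d) := Num.max 0 (b x).
have mal : measurable_fun setT al.
  by apply: measurable_maxr => //; exact: measurable_cst.
have al0 x : 0 <= al x by rewrite le_max lexx.
have aal : {ae mu, forall x : Rd R d, a x = al x}.
  by apply: filterS ab => x hx; rewrite /al -hx//; apply/esym/max_idPr.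
have ial : (\int[mu]_x (al x)%:E < +oo)%E.
  apply: le_lt_trans ha_int; apply: le_integral_ae.
  - by move=> x _; rewrite lee_fin.
  - by move=> x _; rewrite lee_fin.
  - by apply: filterS aal => x <- _; rewrite lee_fin ler_norm.
have sub : forall g, C0inf Om g -> Lcal mu Om phi a pm g.
  exact: (C0inf_Lcal hmu hOm ha0 hphi0 hpm hpmpp hbeta hc1 hg mal al0 aal ial).
(* The same countable family, contained in [C0inf Om], settles density and separability. *)
have dense := dense_fam_dense hmu hOm ha0 hphi0 hpm hpmpp hbeta hc1 hg mal al0 aal ial hC1.
split; first exact: sub.
split.
  move=> u hu e e0; have [g [gD hgu]] := dense u hu e e0.
  by exists g; split => //; exact: dense_fam_C0inf.
exists (dense_fam Om); split; first exact: dense_fam_countable.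
split; first by move=> g /dense_fam_C0inf; exact: sub.
exact: dense.
Qed.
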